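(* Let $n\ge 3$ and let $\lambda=(\lambda_1,\lambda_2)$ be a two-row partition of $n$ ($\lambda_1\ge\lambda_2\ge 1$). Then the $[1,n]$-labeled graph $\overline{\Gamma}_\lambda=(\mathrm{RSYT}(\lambda),m,\overline{\mathrm{des}})$ is a $\overline{\mathcal S_n}$-graph, i.e. a $W$-graph for the affine symmetric group $W=\overline{\mathcal S_n}$.
   Context: **Residues and cyclic intervals.** For $k\in\mathbb Z$, $\overline{k}$ is the unique element of $\{1,\dots,n\}$ congruent to $k$ modulo $n$; $[a,b]=\{x\in\mathbb Z\mid a\le x\le b\}$. For $a,b\in\{1,\dots,n\}$, $\langle a,b\rangle\subset\{1,\dots,n\}$ is $\emptyset$ if $a=\overline{b+1}$, and otherwise is the cyclic interval $\{a,\overline{a+1},\dots,b\}$ (start at $a$, add $1$ modulo $n$ until reaching $b$). **Groups.** $\overline{\mathcal S_n}$ is the affine symmetric group, a Coxeter group with simple reflections $s_0=s_n,s_1,\dots,s_{n-1}$ whose Dynkin diagram is the cycle of type $\widetilde A_{n-1}$ ($s_i$ adjacent to $s_{i\pm1}$, indices mod $n$). Simple reflections are identified with $[1,n]$ via $s_i\leftrightarrow i$. **Tableaux.** $\mathrm{RSYT}(\lambda)$ is the set of fillings of the Young diagram of $\lambda$ (English convention) by $1,\dots,n$, each used once, with rows increasing; $T^1$ (top row) and $T^2$ denote the rows of $T$, regarded as sets. Whenever entries are interchanged, rows are re-sorted. $\overline{\mathrm{des}}(T)=\{i\in[1,n]\mid i\text{ lies in a strictly higher row of }T\text{ than }\overline{i+1}\}$.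 **Labeled graphs and $W$-graphs.** For a Coxeter group $W$ with simple reflections $I$, an $I$-labeled graph $(V,m,\tau)$ consists of a set $V$, maps $m:V\times V\to\mathbb Z[q^{\pm1/2}]$ (written $m(u\triangleright v)$) and $\tau:V\to\{\text{subsets of }I\}$, such that for each $v$ only finitely many $w$ have $m(v\triangleright w)\ne0$ or $m(w\triangleright v)\neq0$. Let $\mathcal H_W$ be the Iwahori–Hecke algebra over $\mathbb Z[q^{\pm1/2}]$ with generators $T_i$ ($i\in I$) satisfying the braid relations and $(T_i-q)(T_i+1)=0$. The graph is a $W$-graph if the formulas $T_i(u)=qu$ if $i\notin\tau(u)$, and $T_i(u)=-u+q^{1/2}\sum_{v:\,i\notin\tau(v)}m(u\triangleright v)\,v$ if $i\in\tau(u)$, define an $\mathcal H_W$-module structure on $\bigoplus_{v\in V}\mathbb Z[q^{\pm1/2}]v$. **The graph $\overline\Gamma_\lambda$.** Its vertex set is $\mathrm{RSYT}(\lambda)$, $\tau=\overline{\mathrm{des}}$, and $m(s\triangleright t)\in\{0,1\}$ with $m(s\triangleright t)=1$ iff there is a move from $s$ to $t$ of one of the following kinds. 1. (First kind) $t$ is obtained from $s$ by interchanging $\overline i$ and $\overline{i+1}$, where $\overline i\in s^1$ and $\overline{i+1}\in s^2$. 2. (Second kind) $t$ is obtained from $s$ by interchanging $\overline i$ and $\overline j$, where $\overline i\in s^2$, $\overline j\in s^1$, $\overline i\ne\overline{j+1}$, and: (a) $\overline{j-i}$ is odd; (b) $\overline{i+1}\in s^1$ and $\overline{j-1}\in s^2$;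 (c) $\overline{i-1}\in s^1$ or $\overline{j+1}\in s^2$; (d) $\#(s^2\cap\langle\overline{j-1-2k},\overline{j-2}\rangle)\ge k$ for all $k\in\{1,\dots,\frac{\overline{j-i}-3}{2}\}$; (e) $\#(s^2\cap\langle\overline{i+2},\overline{j-2}\rangle)=\frac{\overline{j-i}-3}{2}$ when $\overline j\ne\overline{i+1}$. *)

(* Defs.v *)
From HB Require Import structures.
From mathcomp Require Import all_boot all_order all_algebra.
From mathcomp Require Import generic_quotient fraction.
From mathcomp Require Import boolp.
From mathcomp.multinomials Require Import monalg.

Set Implicit Arguments.
Unset Strict Implicit.
Unset Printing Implicit Defensive.

Import GRing.Theory.
Local Open Scope ring_scope.
Local Open Scope quotient_scope.

(** * The ring Z[q^{1/2}, q^{-1/2}] *)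

(* Localization of Z['X] at 'X, inside its fraction field; 'X is q^{1/2}. *)
Definition laurent_pred : pred {fraction {poly int}} := fun x =>
  `[< exists k (p : {poly int}), x = tofrac p / tofrac 'X ^+ k >].

Fact laurent_subring : subring_closed laurent_pred.
Proof.
have XF k : tofrac 'X ^+ k != 0 :> {fraction {poly int}}.
  by rewrite expf_neq0 // tofrac_eq0 polyX_eq0.
split.
- by apply/asboolP; exists 0%N, 1; rewrite expr0 divr1 tofrac1.
- move=> x y /asboolP[k [p ->]] /asboolP[l [r ->]]; apply/asboolP.
  exists (k + l)%N, (p * 'X^l - r * 'X^k).
  rewrite tofracB !tofracM !tofracXn mulrBl exprD; congr (_ - _).
  + by rewrite -mulf_div divff ?mulr1.
  + by rewrite [_ ^+ k * _]mulrC -mulf_div divff ?mulr1.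
- move=> x y /asboolP[k [p ->]] /asboolP[l [r ->]]; apply/asboolP.
  by exists (k + l)%N, (p * r); rewrite tofracM exprD mulf_div.
Qed.

HB.instance Definition _ :=
  GRing.isSubringClosed.Build _ laurent_pred laurent_subring.

Record laurent := Laurent { laurent_val :> {fraction {poly int}};
                            _ : laurent_val \in laurent_pred }.
HB.instance Definition _ := [isSub for laurent_val].
HB.instance Definition _ := [Choice of laurent by <:].
HB.instance Definition _ := [SubChoice_isSubComNzRing of laurent by <:].

Fact sqrtq_subproof : tofrac 'X \in laurent_pred.
Proof. by apply/asboolP; exists 0%N, 'X; rewrite expr0 divr1. Qed.

Definition sqrtq : laurent := Laurent sqrtq_subproof.
Definition q : laurent := sqrtq ^+ 2.

(** * Quotients of rings by two-sided ideals *)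

Inductive gen_ideal (A : pzRingType) (S : A -> Prop) : A -> Prop :=
  | gen_ideal_base x of S x : gen_ideal S x
  | gen_ideal0 : gen_ideal S 0
  | gen_idealD x y of gen_ideal S x & gen_ideal S y : gen_ideal S (x + y)
  | gen_idealMl a x of gen_ideal S x : gen_ideal S (a * x)
  | gen_idealMr a x of gen_ideal S x : gen_ideal S (x * a).

Section RingQuotient.
Variables (A : pzRingType) (S : A -> Prop).

Definition ideal_equiv : rel A := fun x y => `[< gen_ideal S (x - y) >].

Fact ideal_equivP : equiv_class_of ideal_equiv.
Proof.
split=> [x|x y|y x z].
- by apply/asboolP; rewrite subrr; exact: gen_ideal0.
- by apply/asboolP/asboolP => h; rewrite -opprB -mulN1r; exact: gen_idealMl.
- move=> /asboolP h1 /asboolP h2; apply/asboolP.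
  by rewrite -[x](subrK y) -addrA; exact: gen_idealD.
Qed.

Canonical ideal_equiv_equiv := EquivRelPack ideal_equivP.
Canonical ideal_equiv_encModRel := defaultEncModRel ideal_equiv.

Definition ring_quot := {eq_quot ideal_equiv}.

HB.instance Definition _ : EqQuotient A ideal_equiv ring_quot :=
  EqQuotient.on ring_quot.
HB.instance Definition _ := Choice.on ring_quot.

Fact eq_ring_quot (x y : A) :
  gen_ideal S (x - y) -> \pi_ring_quot x = \pi_ring_quot y.
Proof. by move=> h; apply/eqmodP/asboolP. Qed.

Fact ring_quot_repr (x : A) : gen_ideal S (repr (\pi_ring_quot x) - x).
Proof. by apply/asboolP; rewrite -[`[< _ >]]/(ideal_equiv _ _) -eqmodE reprK. Qed.

Definition rq_zero : ring_quot := lift_cst ring_quot 0.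
Definition rq_one : ring_quot := lift_cst ring_quot 1.
Definition rq_opp := lift_op1 ring_quot -%R.
Definition rq_add := lift_op2 ring_quot +%R.
Definition rq_mul := lift_op2 ring_quot *%R.

Canonical pi_rq_zero_morph := PiConst rq_zero.
Canonical pi_rq_one_morph := PiConst rq_one.

Fact pi_rq_opp : {morph \pi_ring_quot : x / - x >-> rq_opp x}.
Proof.
move=> x; unlock rq_opp; apply/esym/eq_ring_quot.
rewrite -opprD -[- (_ - _)]mulN1r; apply: gen_idealMl.
exact: ring_quot_repr.
Qed.

Canonical pi_rq_opp_morph := PiMorph1 pi_rq_opp.

Fact pi_rq_add : {morph \pi_ring_quot : x y / x + y >-> rq_add x y}.
Proof.
move=> x y; unlock rq_add; apply/esym/eq_ring_quot.
rewrite opprD addrACA.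
by apply: gen_idealD; exact: ring_quot_repr.
Qed.

Canonical pi_rq_add_morph := PiMorph2 pi_rq_add.

Fact pi_rq_mul : {morph \pi_ring_quot : x y / x * y >-> rq_mul x y}.
Proof.
move=> x y; unlock rq_mul; apply/esym/eq_ring_quot.
set x' := repr _; set y' := repr _.
have -> : x' * y' - x * y = (x' - x) * y' + x * (y' - y).
  by rewrite mulrBl mulrBr addrA subrK.
by apply: gen_idealD; [apply: gen_idealMr | apply: gen_idealMl];
  exact: ring_quot_repr.
Qed.

Canonical pi_rq_mul_morph := PiMorph2 pi_rq_mul.

Fact rq_addA : associative rq_add.
Proof.
move=> x y z; rewrite -[x]reprK -[y]reprK -[z]reprK.
by rewrite !piE addrA.
Qed.
Fact rq_addC : commutative rq_add.
Proof. by move=> x y; rewrite -[x]reprK -[y]reprK !piE addrC. Qed.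
Fact rq_add0 : left_id rq_zero rq_add.
Proof. by move=> x; rewrite -[x]reprK !piE add0r. Qed.
Fact rq_addN : left_inverse rq_zero rq_opp rq_add.
Proof. by move=> x; rewrite -[x]reprK !piE addNr. Qed.

HB.instance Definition _ :=
  GRing.isZmodule.Build ring_quot rq_addA rq_addC rq_add0 rq_addN.

Fact rq_mulA : associative rq_mul.
Proof.
move=> x y z; rewrite -[x]reprK -[y]reprK -[z]reprK.
by rewrite !piE mulrA.
Qed.
Fact rq_mul1 : left_id rq_one rq_mul.
Proof. by move=> x; rewrite -[x]reprK !piE mul1r. Qed.
Fact rq_mulr1 : right_id rq_one rq_mul.
Proof. by move=> x; rewrite -[x]reprK !piE mulr1. Qed.
Fact rq_mulDl : left_distributive rq_mul rq_add.
Proof.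
move=> x y z; rewrite -[x]reprK -[y]reprK -[z]reprK.
by rewrite !piE mulrDl.
Qed.
Fact rq_mulDr : right_distributive rq_mul rq_add.
Proof.
move=> x y z; rewrite -[x]reprK -[y]reprK -[z]reprK.
by rewrite !piE mulrDr.
Qed.

(* The quotient may be the zero ring, hence only a pzRingType. *)
HB.instance Definition _ := GRing.Zmodule_isPzRing.Build ring_quot
  rq_mulA rq_mul1 rq_mulr1 rq_mulDl rq_mulDr.

End RingQuotient.

(** * Iwahori-Hecke algebras *)

(* [M] is a Coxeter matrix, the value 0 standing for infinity: the braid
   relation it yields below is 1 - 1. *)
Section Hecke.
Variables (I : finType) (M : I -> I -> nat).

Definition hecke_free : lalgType laurent := {malg laurent[{fmonom I}]}.

Definition free_gen (i : I) : hecke_free := << fmu i >>.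

(* T_i T_j T_i ... , with k factors *)
Definition alt_prod (k : nat) (i j : I) : hecke_free :=
  \prod_(l < k) free_gen (if odd l then j else i).

Inductive hecke_rel : hecke_free -> Prop :=
  | hecke_quad i : hecke_rel ((free_gen i - q%:A) * (free_gen i + 1))
  | hecke_braid i j : hecke_rel (alt_prod (M i j) i j - alt_prod (M i j) j i).

Definition hecke : pzRingType := ring_quot hecke_rel.

Definition hecke_gen (i : I) : hecke := \pi_(ring_quot hecke_rel) (free_gen i).

(* The structure map of [hecke] as an algebra over Z[q^{1/2}, q^{-1/2}] *)
Definition hecke_scalar (c : laurent) : hecke :=
  \pi_(ring_quot hecke_rel) (c%:A : hecke_free).

End Hecke.

(** * W-graphs *)

(* [act] is the action map of a left [hecke M]-module structure on [V] that
   extends its structure of module over Z[q^{1/2}, q^{-1/2}]. *)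
Record is_hecke_module (I : finType) (M : I -> I -> nat) (V : lmodType laurent)
    (act : hecke M -> V -> V) : Prop := {
  act1 : forall v, act 1 v = v;
  actM : forall a b v, act (a * b) v = act a (act b v);
  actDl : forall a b v, act (a + b) v = act a v + act b v;
  actDr : forall a u v, act a (u + v) = act a u + act a v;
  act_scalar : forall c v, act (hecke_scalar M c) v = c *: v
}.

(* Only finite vertex sets are needed, so local finiteness is automatic. *)
Record labeled_graph (I : finType) := LabeledGraph {
  vertex : finType;
  weight : vertex -> vertex -> laurent;
  label : vertex -> {set I}
}.

Section WGraph.
Variables (I : finType) (M : I -> I -> nat) (G : labeled_graph I).

Definition vertex_module : lmodType laurent := {malg laurent[vertex G]}.

Definition vertex_basis (v : vertex G) : vertex_module := << v >>.

Definition wgraph_formula (i : I) (u : vertex G) : vertex_module :=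
  if i \in label u then
    - vertex_basis u +
      sqrtq *: \sum_(v | i \notin label v) weight u v *: vertex_basis v
  else q *: vertex_basis u.

Definition is_wgraph : Prop :=
  exists2 act : hecke M -> vertex_module -> vertex_module,
    is_hecke_module act &
    forall i u, act (hecke_gen M i) (vertex_basis u) = wgraph_formula i u.

End WGraph.

(* Simple reflections are indexed by 'I_n = {0, ..., n-1}, with s_0 = s_n.
   This is the matrix of the affine symmetric group for n >= 3. *)
Definition affine_coxeter (n : nat) (i j : 'I_n) : nat :=
  if i == j then 1%N
  else if (val j == i.+1 %% n)%N || (val i == j.+1 %% n)%N then 3%N
  else 2%N.

(** * Residues and cyclic intervals *)

(* The representative of [k] modulo [n] in {1, ..., n}. *)
Definition bar (n : nat) (k : int) : nat := `|((k - 1) %% n)%Z|%N.+1.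

(* For [a] and [b] in {1, ..., n}. *)
Definition cyc_itv (n a b : nat) : seq nat :=
  if a == bar n (b%:Z + 1) then [::]
  else traject (fun x : nat => bar n (x%:Z + 1)) a (bar n (b%:Z - a%:Z + 1)).

(** * Two-row tableaux *)

Section Tableaux.
Variables n l1 l2 : nat.

Definition is_rsyt (T : l1.-tuple 'I_n.+1 * l2.-tuple 'I_n.+1) : bool :=
  [&& sorted ltn (map val T.1), sorted ltn (map val T.2)
    & perm_eq (map val T.1 ++ map val T.2) (iota 1 n)].

Record rsyt := RSYT {
  rsyt_val : l1.-tuple 'I_n.+1 * l2.-tuple 'I_n.+1;
  _ : is_rsyt rsyt_val
}.
HB.instance Definition _ := [isSub for rsyt_val].
HB.instance Definition _ := [Finite of rsyt by <:].

Definition top_row (T : rsyt) : seq nat := map val (rsyt_val T).1.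
Definition bot_row (T : rsyt) : seq nat := map val (rsyt_val T).2.

(* The element [i] of 'I_n stands for the entry [bar n i]. *)
Definition affine_des (T : rsyt) : {set 'I_n} :=
  [set i : 'I_n | (bar n i%:Z \in top_row T) && (bar n (i%:Z + 1) \in bot_row T)].

Definition swap_entries (a b x : nat) : nat :=
  if x == a then b else if x == b then a else x.

Definition is_interchange (a b : nat) (s t : rsyt) : bool :=
  (top_row t == sort leq (map (swap_entries a b) (top_row s))) &&
  (bot_row t == sort leq (map (swap_entries a b) (bot_row s))).

Local Notation bar := (bar n).

Definition move1_at (i : int) (s t : rsyt) : bool :=
  [&& bar i \in top_row s, bar (i + 1) \in bot_row s
    & is_interchange (bar i) (bar (i + 1)) s t].

(* #(s^2 :&: <a, b>) *)
Definition count2 (s : rsyt) (a b : nat) : nat :=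
  count (mem (bot_row s)) (cyc_itv n a b).

(* [d] is odd, so the truncated (d - 3) %/ 2 differs from (d - 3) / 2 only when
   d = 1, where both conditions using it are void. *)
Definition move2_at (i j : int) (s t : rsyt) : bool :=
  let d := bar (j - i) in
  [&& bar i \in bot_row s, bar j \in top_row s, bar i != bar (j + 1),
      odd d,
      bar (i + 1) \in top_row s, bar (j - 1) \in bot_row s,
      (bar (i - 1) \in top_row s) || (bar (j + 1) \in bot_row s),
      all (fun k : nat => k <=
             count2 s (bar (j - 1 - 2 * k%:Z)) (bar (j - 2)))%N
          (iota 1 ((d - 3) %/ 2)%N),
      (bar j != bar (i + 1)) ==>
        (count2 s (bar (i + 2)) (bar (j - 2)) == (d - 3) %/ 2)%N
    & is_interchange (bar i) (bar j) s t].

(* The conditions depend only on [i] and [j] modulo [n]. *)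
Definition move (s t : rsyt) : bool :=
  [exists i : 'I_n, move1_at i%:Z s t] ||
  [exists i : 'I_n, exists j : 'I_n, move2_at i%:Z j%:Z s t].

Definition affine_graph : labeled_graph 'I_n :=
  @LabeledGraph 'I_n rsyt (fun s t => (move s t)%:R) affine_des.

End Tableaux.

(* Main.v *)
(** Write F_i = q - T_i. A tableau is the same thing as an n-periodic lattice
    path with an up-step for each entry of the top row and a down-step for each
    entry of the bottom row. Matching steps of the path at equal heights turns
    it into an annular link pattern, and the cup-cap generator e_i of the
    Temperley-Lieb algebra defines a partial map g_i on paths: it fixes the
    paths having a local maximum at i (i is a descent), raises a local minimum
    at i (a move of the first kind read backwards), lowers by 2 the excursion
    above the level of i that starts or ends at i (a move of the second kind
    read backwards), and is undefined if there is no such excursion. On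
    coordinates F_i acts by pullback along g_i, with scalar 1 + q at the
    descents and - q^(1/2) elsewhere. So the Hecke relations reduce to
    g_i g_j = g_j g_i when i and j are not adjacent, and to
    g_i g_j g_i = g_i when they are. *)

Require Import Defs.
From mathcomp Require Import all_boot.
From mathcomp Require Import all_order all_algebra.
From mathcomp Require Import generic_quotient boolp finmap.
From mathcomp.multinomials Require Import monalg.
From mathcomp Require Import zify ring.

Set Implicit Arguments.
Unset Strict Implicit.
Unset Printing Implicit Defensive.

Import Order.TTheory GRing.Theory Num.Theory.

Local Open Scope ring_scope.

(** * Height functions *)

(** The paths live on the integers and not on the circle, so that an arc of the annulus is an
    interval and winding becomes translation by multiples of [n]. In return, tableaux correspond to
    paths only up to an additive constant, and the two arguments of [flip] may be translated
    together. The obstacle is that an arc might wrap round the annulus and meet its own translates;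
    [exc_lt_n] rules this out wherever g_i lowers an excursion. For i and j not adjacent, one
    implication suffices: if g_j g_i is defined at a path, then so is g_i g_j, with the same value
    and as many local maxima met on the way, hence the same scalar. Exchanging i and j settles the
    paths where one composition is undefined. The proof matches explicit flips, according to how the
    second map touches the excursion moved by the first. Pullback reverses composition: F_i F_j
    evaluates at g_j g_i. In g_i g_j g_i the last two maps both move the path, so they contribute (-
    q^(1/2))^2 = q. Then F_i^2 = (1 + q) F_i and F_i F_j F_i = q F_i give the quadratic and braid
    relations by expansion. *)

(* Steps are indexed by their right endpoint. *)
Definition step (h : int -> int) (x : int) := h x - h (x - 1).

Lemma height_succ (h : int -> int) (x : int) : h (x + 1) = h x + step h (x + 1).
Proof. by rewrite /step addrK; lia. Qed.

Lemma height_pred (h : int -> int) (x : int) : h (x - 1) = h x - step h x.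
Proof. by rewrite /step; lia. Qed.

Lemma step_const (h h' : int -> int) (e x : int) : (forall y, h' y = h y + e) -> step h' x = step h x.
Proof. by move=> E; rewrite /step !E; lia. Qed.

(** * Paths periodic up to a drift, and the flip of two steps *)

Section Heights.
Variable n : nat.
Hypothesis n_ge3 : (3 <= n)%N.
Implicit Types (h u : int -> int) (a b c d i j k p r x y : int).

Definition height h :=
  (forall x, step h x = 1 \/ step h x = -1) /\
  exists t : int, forall x, h (x + n%:Z) = h x + t.

Definition quo c x := ((x - c) %/ n%:Z)%Z.

(* Modulo n, turns the up-step c into a down-step and the down-step d into an
   up-step. For c < d <= c + n this lowers h by 2 on the translates of [c, d); for
   c = d + 1 it raises h by 2 on the translates of d. *)
Definition flip c d h x := h x - 2 * quo c x + 2 * quo d x.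

Definition noncong x y := forall k, x <> y + k * n%:Z.

Lemma muln_cases k : k * n%:Z = 0 \/ n%:Z <= k * n%:Z \/ k * n%:Z <= - n%:Z.
Proof.
have [->|[k1|k1]] : k = 0 \/ 1 <= k \/ k <= -1 by lia.
- by left; rewrite mul0r.
- by right; left; have : 1 * n%:Z <= k * n%:Z by [exact: ler_wpM2r]; lia.
- by right; right; have : k * n%:Z <= -1 * n%:Z by [exact: ler_wpM2r]; lia.
Qed.

Lemma noncong_sym x y : noncong x y -> noncong y x.
Proof. by move=> H k; move: (H (- k)); lia. Qed.

Lemma noncong_small x y : 0 < `|x - y| < n%:Z -> noncong x y.
Proof.
by move=> H k E; have := muln_cases k; lia.
Qed.

Lemma height_shift h k : height h -> exists t : int, forall x, h (x + k * n%:Z) = h x + t.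
Proof.
case=> _ [t ht].
have pos (m : nat) x : h (x + m%:Z * n%:Z) = h x + m%:Z * t.
  elim: m => [|m IH]; first by rewrite !mul0r !addr0.
  have -> : x + m.+1%:Z * n%:Z = x + m%:Z * n%:Z + n%:Z by lia.
  by rewrite ht IH; lia.
exists (k * t) => x; case: (leP 0 k) => k0.
  by have := pos `|k|%N x; have -> : `|k|%N%:Z = k by lia.
have Ek : `|k|%N%:Z = - k by lia.
have := pos `|k|%N (x + k * n%:Z); rewrite Ek.
have -> : x + k * n%:Z + - k * n%:Z = x by lia.
by move=> ->; lia.
Qed.

Lemma step_shift h x k : height h -> step h (x + k * n%:Z) = step h x.
Proof.
move=> hh; have [t ht] := height_shift k hh.
rewrite /step; have -> : x + k * n%:Z - 1 = x - 1 + k * n%:Z by lia.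
by rewrite !ht; lia.
Qed.

Lemma noncong_step h x y : height h -> step h x <> step h y -> noncong x y.
Proof. by move=> hh H k E; apply: H; rewrite E step_shift. Qed.

Lemma divz_pred x : ((x - 1) %/ n%:Z)%Z = (x %/ n%:Z)%Z - (n%:Z %| x)%Z%:R.
Proof.
have n0 : (n%:Z != 0) by lia.
have := divz_eq x n%:Z; have := modz_ge0 x n0; have := ltz_mod x n0.
set qx := (x %/ _)%Z; set rx := (x %% _)%Z => lt ge E.
have dv : (n%:Z %| x)%Z = (rx == 0).
  by apply/idP/eqP => [/dvdz_mod0P|/dvdz_mod0P].
rewrite dv; case: eqP => r0 /=.
  have -> : x - 1 = (qx - 1) * n%:Z + (n%:Z - 1) by rewrite E r0; lia.
  by rewrite divzMDl // divz_small ?addr0 //; lia.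
have -> : x - 1 = qx * n%:Z + (rx - 1) by rewrite {1}E; lia.
rewrite divzMDl // divz_small; lia.
Qed.

Lemma step_flip h c d x :
  step (flip c d h) x = step h x - 2 * (n%:Z %| x - c)%Z%:R + 2 * (n%:Z %| x - d)%Z%:R.
Proof.
rewrite /step /flip /quo.
have -> : x - 1 - c = x - c - 1 by lia.
have -> : x - 1 - d = x - d - 1 by lia.
by rewrite !divz_pred; lia.
Qed.

Lemma noncong_dvd x y : noncong x y -> (n%:Z %| x - y)%Z = false.
Proof. by move=> H; apply/negP => /dvdzP[k E]; apply: (H k); lia. Qed.

Lemma step_flip_out h c d x : noncong x c -> noncong x d -> step (flip c d h) x = step h x.
Proof. by move=> /noncong_dvd H1 /noncong_dvd H2; rewrite step_flip H1 H2; lia. Qed.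

Lemma step_flip_c h c d : noncong c d -> step (flip c d h) c = step h c - 2.
Proof. by move=> /noncong_dvd H1; rewrite step_flip H1 subrr dvdz0; lia. Qed.

Lemma step_flip_d h c d : noncong c d -> step (flip c d h) d = step h d + 2.
Proof. by move=> /noncong_sym /noncong_dvd H1; rewrite step_flip H1 subrr dvdz0; lia. Qed.

Lemma quo_shift c k x : quo (c + k * n%:Z) x = quo c x - k.
Proof.
rewrite /quo; have -> : x - (c + k * n%:Z) = (- k) * n%:Z + (x - c) by lia.
by rewrite divzMDl; lia.
Qed.

Lemma flip_shift h c d k : flip (c + k * n%:Z) (d + k * n%:Z) h =1 flip c d h.
Proof.
by move=> x; rewrite /flip !quo_shift; lia.
Qed.

Lemma height_flip h c d : height h -> step h c = 1 -> step h d = - 1 -> height (flip c d h).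
Proof.
move=> hh hc hd; have ncd : noncong c d by apply: (noncong_step hh); rewrite hc hd.
split; last first.
  have [_ [t ht]] := hh; exists t => x; rewrite /flip /quo ht.
  have -> : x + n%:Z - c = 1 * n%:Z + (x - c) by lia.
  have -> : x + n%:Z - d = 1 * n%:Z + (x - d) by lia.
  by rewrite !divzMDl; lia.
move=> x; have [s _] := hh; rewrite step_flip.
case: (boolP (n%:Z %| x - c)%Z) => [/dvdzP[k E]|_].
  have Ex : x = c + k * n%:Z by lia.
  rewrite Ex step_shift // hc noncong_dvd; first by lia.
  by move=> k' E'; apply: (ncd (k' - k)); lia.
case: (boolP (n%:Z %| x - d)%Z) => [/dvdzP[k E]|_]; last by move: (s x) => /=; lia.
have Ex : x = d + k * n%:Z by lia.
by rewrite Ex step_shift // hd; lia.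
Qed.

(** * Excursions, and how they react to lowering and raising *)

Definition exc h a b := [/\ a < b, h b = h a & forall y, a < y < b -> h a < h y].

Lemma exc_shift h a b k : height h -> exc h a b -> exc h (a + k * n%:Z) (b + k * n%:Z).
Proof.
move=> hh [ab e gt]; have [t ht] := height_shift k hh; split; rewrite ?ht; try lia.
move=> y hy; have := gt (y - k * n%:Z); have := ht (y - k * n%:Z); rewrite subrK.
by move=> ->; lia.
Qed.

(** An excursion longer than [n] contains [a + n] and [b - n], which makes the drift both positive
    and negative. Length exactly [n] forces drift 0; then the steps into [a] and into [b] are
    translates of each other, as are those out of [a] and out of [b], against the last
    hypothesis. *)
Lemma exc_lt_n h a b : height h -> exc h a b ->
  step h a = 1 \/ step h (b + 1) = - 1 -> b - a < n%:Z.
Proof.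
move=> hh [ab e gt] st; have [_ [t ht]] := hh.
case: (ltP (b - a) n%:Z) => // lab; exfalso.
have Ea := ht a; have Eb' := ht (b - n%:Z); rewrite subrK in Eb'.
case: (ltP n%:Z (b - a)) => lab'.
  have Q1 : h a < h (a + n%:Z) by apply: gt; lia.
  have Q2 : h a < h (b - n%:Z) by apply: gt; lia.
  by lia.
have Eb : b = a + n%:Z by lia.
have t0 : t = 0 by move: Ea; rewrite -Eb; lia.
case: st; rewrite /step.
  have := ht (a - 1); have -> : a - 1 + n%:Z = b - 1 by lia.
  by have := gt (b - 1); lia.
rewrite addrK; have := ht (a + 1); have -> : a + 1 + n%:Z = b + 1 by lia.
by have := gt (a + 1); lia.
Qed.

(** Excursions are the arcs of a non-crossing matching: if two crossed, each would have an end
    strictly above the level of the other. *)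
Lemma exc_laminar h a b c d : exc h a b -> exc h c d ->
  b <= c \/ d <= a \/ (a < c /\ d < b) \/ (c < a /\ b < d) \/ (a = c /\ b = d).
Proof.
move=> [ab eab gab] [cd ecd gcd].
case: (ltgtP a c) => [ac|ca|Eac].
- case: (leP b c) => bc; first by left.
  case: (ltgtP b d) => [bd|db|Ebd]; last by have := gab c; rewrite -Ebd in ecd; lia.
    by have := gab c; have := gcd b; lia.
  by lia.
- case: (leP d a) => da; first by lia.
  case: (ltgtP b d) => [bd|db|Ebd]; first by lia.
    by have := gcd a; have := gab d; lia.
  by have := gcd a; rewrite -Ebd in ecd; lia.
- rewrite -Eac in cd ecd gcd *; case: (ltgtP b d) => [bd|db|Ebd]; last by lia.
    by have := gcd b; lia.
  by have := gab d; lia.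
Qed.

Lemma exc_step h a b : height h -> exc h a b -> step h (a + 1) = 1 /\ step h b = - 1.
Proof.
move=> [s _] [ab e gt]; have := s (a + 1); have := s b.
have := gt (a + 1); have := gt (b - 1); rewrite height_succ height_pred.
have [E|ne] := eqVneq b (a + 1); last by lia.
by move: (height_succ h a); rewrite -E e; lia.
Qed.

Lemma lowerP h a b x : a < b <= a + n%:Z ->
  (exists2 k, a + k * n%:Z < x < b + k * n%:Z & flip (a + 1) b h x = h x - 2) \/
  ((forall k, ~ (a + k * n%:Z < x < b + k * n%:Z)) /\ flip (a + 1) b h x = h x).
Proof.
move=> ab; have n0 : (0 < n%:Z) by lia.
rewrite /flip /quo; set k1 := (_ %/ _)%Z; set k2 := (_ %/ _)%Z.
(* [k1] and [k2] number the last translates of [a + 1] and of [b] not beyond [x]. As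
   [a < b <= a + n], they are equal or [k1 = k2 + 1], the latter exactly on the lowered
   stretches. *)
have H1 k : (k <= k1) = (k * n%:Z <= x - (a + 1)) by rewrite lez_divRL.
have H2 k : (k <= k2) = (k * n%:Z <= x - b) by rewrite lez_divRL.
have E1 := H1 k1; have E2 := H2 k2; have E3 := H1 (k1 + 1); have E4 := H2 (k2 + 1).
have E5 := H1 k2; have E6 := H2 k1; have E7 := H1 (k2 + 1); have E8 := H1 (k2 + 2).
case: (eqVneq k1 k2) => [E|ne].
  right; split; last by lia.
  by move=> k Hk; move: (H1 k) (H2 k); rewrite E; lia.
left; exists k1; first by lia.
have : k1 = k2 + 1 by lia.
by lia.
Qed.

Lemma raiseP h i x :
  (exists2 k, x = i + k * n%:Z & flip (i + 1) i h x = h x + 2) \/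
  (noncong x i /\ flip (i + 1) i h x = h x).
Proof.
rewrite /flip /quo; have -> : x - (i + 1) = x - i - 1 by lia.
rewrite divz_pred; case: (boolP (n%:Z %| x - i)%Z) => [/dvdzP[k E]|nd].
  by left; exists k; lia.
right; split; last by lia.
by move=> k E; case/negP: nd; apply/dvdzP; exists k; lia.
Qed.

Lemma lower_in h a b k x : a < b <= a + n%:Z -> a + k * n%:Z < x < b + k * n%:Z ->
  flip (a + 1) b h x = h x - 2.
Proof. by move=> ab xk; have [[]//|[/(_ k)]] := lowerP h x ab. Qed.

Lemma lower_out h a b x : a < b <= a + n%:Z ->
  (forall k, ~ (a + k * n%:Z < x < b + k * n%:Z)) -> flip (a + 1) b h x = h x.
Proof. by move=> ab xk; have [[k /xk]|[]] := lowerP h x ab. Qed.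

Lemma lower_le h a b x : a < b <= a + n%:Z -> flip (a + 1) b h x <= h x.
Proof. by move=> ab; have [[k _ ->]|[_ ->]] := lowerP h x ab; lia. Qed.

Lemma raise_ge h i x : h x <= flip (i + 1) i h x.
Proof. by have [[k _ ->]|[_ ->]] := raiseP h i x; lia. Qed.

Lemma raise_out h i x : noncong x i -> flip (i + 1) i h x = h x.
Proof. by move=> H; have [[k /H]|[]] := raiseP h i x. Qed.

(** By laminarity, a translate of the lowered excursion that meets this one either covers it, ends
    included, and lowers all of it equally, or is nested in it. A nested one with base at least 2
    above [h a] remains above [h a] after lowering. *)
Lemma exc_lower h a b c d : height h -> exc h a b -> exc h c d -> d - c <= n%:Z ->
    (forall k, ~ (a = c + k * n%:Z /\ b = d + k * n%:Z)) ->
    (forall k, a < c + k * n%:Z -> d + k * n%:Z < b -> h a + 2 <= h (c + k * n%:Z)) ->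
  exc (flip (c + 1) d h) a b.
Proof.
move=> hh eab ecd len neq deep; have cd : c < d <= c + n%:Z by case: ecd; lia.
have [ab e gt] := eab.
have [[k ka fa]|[ka fa]] := lowerP h a cd.
  have kb : b < d + k * n%:Z.
    have := neq k; have := exc_laminar eab (exc_shift k hh ecd); lia.
  split=> //; first by rewrite fa (@lower_in h c d k) //; lia.
  by move=> y hy; have := gt y hy; rewrite fa (@lower_in h c d k) //; lia.
have fb : flip (c + 1) d h b = h b.
  apply: lower_out => // k kb.
  have := exc_laminar eab (exc_shift k hh ecd); have := ka k; lia.
split=> //; first by rewrite fa fb.
move=> y hy; rewrite fa; have := gt y hy.
have [[k ky ->]|[_ ->]//] := lowerP h y cd.
have excK := exc_shift k hh ecd; have [_ _ /(_ y ky)] := excK.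
have := exc_laminar eab excK; have := neq k; have := ka k; have := deep k; lia.
Qed.

Lemma exc_raise h a b i : exc h a b -> noncong a i -> noncong b i ->
  exc (flip (i + 1) i h) a b.
Proof.
move=> [ab e gt] na nb; split; rewrite ?raise_out // => y /gt lt.
exact: lt_le_trans (raise_ge h i y).
Qed.

(** Undoing the raise affects a single point of the excursion. If that point returns to the base
    level, it cuts the excursion in two. It cannot drop below, since its predecessor is not [a] and
    so lies above the base. *)
Lemma exc_of_raise h a b i : height h -> b - a < n%:Z ->
    exc (flip (i + 1) i h) a b -> noncong a i -> noncong b i -> noncong a (i - 1) ->
  exc h a b \/ exists k, exc h a (i + k * n%:Z) /\ exc h (i + k * n%:Z) b.
Proof.
move=> hh len [ab e gt] na nb na'; rewrite !raise_out // in e gt.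
(* [i + k * n] is the last translate of [i] before [b]; as [b - a < n], no other one lies strictly
   between [a] and [b]. *)
have [k Hk] : exists k : int, k * n%:Z <= b - 1 - i < k * n%:Z + n%:Z.
  exists ((b - 1 - i) %/ n%:Z)%Z; have := divz_eq (b - 1 - i) n%:Z.
  have n0 : n%:Z != 0 by lia.
  by have := modz_ge0 (b - 1 - i) n0; have := ltz_mod (b - 1 - i) n0; lia.
pose i' := i + k * n%:Z.
have lift y k' : a < y < b -> y = i + k' * n%:Z -> y = i'.
  move=> hy Ey; have [E|ne] := eqVneq k' k; first by rewrite Ey E.
  by have := muln_cases (k' - k); lia.
have gt' y : a < y < b -> y <> i' -> h a < h y.
  move=> hy ne; have := gt y hy; have [[k' /(lift _ _ hy)//]|[_ ->]//] := raiseP h i y.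
have [/andP[bd /eqP e']|] := boolP ((a < i' < b) && (h i' == h a)).
  right; exists k; rewrite -/i'; split; split; try lia.
    by move=> y hy; apply: gt'; lia.
  by move=> y hy; rewrite e'; apply: gt'; lia.
move=> nb'; left; split=> // y hy; have [E|/eqP ne] := eqVneq y i'; last exact: gt'.
have := gt y hy; move: nb'; rewrite -E hy /= => /eqP ne.
have [[k' _ ->]|[_ ->]//] := raiseP h i y.
have := gt' (y - 1); have := hh.1 y; rewrite height_pred.
have : a <> y - 1 by move: (na' k); lia.
by lia.
Qed.

(* The map g_i, as flip c d. The boolean tells whether i is a local maximum of h,
   in which case nothing moves. *)
Inductive gmove i h : bool -> int -> int -> Prop :=
| gmax c of step h i = 1 & step h (i + 1) = -1 : gmove i h true c c
| gmin of step h i = -1 & step h (i + 1) = 1 : gmove i h false (i + 1) i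
| gup p of step h i = 1 & step h (i + 1) = 1 & exc h i p : gmove i h false (i + 1) p
| gdn r of step h i = -1 & step h (i + 1) = -1 & exc h r i : gmove i h false (r + 1) i.

(** * Commutation of g_i and g_j for non-adjacent indices *)

Definition apart i j := [/\ noncong i (j - 1), noncong i j & noncong i (j + 1)].

Lemma apart_sym i j : apart i j -> apart j i.
Proof.
by case=> H1 H2 H3; split=> k; [move: (H3 (- k))|move: (H2 (- k))|move: (H1 (- k))]; lia.
Qed.

Lemma apart_shiftl i j k : apart i j -> apart (i + k * n%:Z) j.
Proof.
by case=> H1 H2 H3; split=> l; [move: (H1 (l - k))|move: (H2 (l - k))|move: (H3 (l - k))]; lia.
Qed.

Definition gmove_mod i h m c d := exists k : int, gmove (i + k * n%:Z) h m c d.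

(* g_j g_i = g_i g_j at h, where g_i = flip c d and g_j = flip c2 d2 on the left.
   The sum s of the two booleans determines the scalar. *)
Definition completes h i j s c d c2 d2 :=
  exists m' c' d' m'' c'' d'', [/\ gmove_mod j h m' c' d',
    gmove_mod i (flip c' d' h) m'' c'' d'', (m' + m'' = s)%N
  & flip c2 d2 (flip c d h) =1 flip c'' d'' (flip c' d' h)].

Lemma gmove_id i h m c d : gmove i h m c d -> gmove_mod i h m c d.
Proof. by exists 0; rewrite mul0r addr0. Qed.

Lemma gmove_shift h i m c d k : height h -> gmove i h m c d ->
  gmove (i + k * n%:Z) h m (c + k * n%:Z) (d + k * n%:Z).
Proof.
have add1 x : x + 1 + k * n%:Z = x + k * n%:Z + 1 by lia.
move=> hh; case=> [{}c|||] *.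
- by apply: gmax; rewrite -?add1 step_shift.
- by rewrite add1; apply: gmin; rewrite -?add1 step_shift.
- by rewrite add1; apply: gup; rewrite -?add1 ?step_shift //; apply: exc_shift.
- by rewrite add1; apply: gdn; rewrite -?add1 ?step_shift //; apply: exc_shift.
Qed.

Lemma flip_eq1 h h' c d : h =1 h' -> flip c d h =1 flip c d h'.
Proof. by move=> E x; rewrite /flip E. Qed.

Lemma flipK c h : flip c c h =1 h.
Proof. by move=> x; rewrite /flip; lia. Qed.

Lemma gmove_const h h' i m c d e : (forall x, h' x = h x + e) ->
  gmove i h m c d -> gmove i h' m c d.
Proof.
move=> E; have Es x : step h' x = step h x by rewrite /step !E; lia.
have Ee a b : exc h a b -> exc h' a b.
  by case=> ab eab gt; split=> // [|y /gt]; rewrite !E; lia.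
case=> *; [apply: gmax|apply: gmin|apply: gup|apply: gdn]; rewrite ?Es //; exact: Ee.
Qed.

Lemma gmove_eq1 h h' i m c d : h =1 h' -> gmove i h m c d -> gmove i h' m c d.
Proof. by move=> E; apply: (@gmove_const _ _ _ _ _ _ 0) => x; rewrite E addr0. Qed.

Lemma gmove_ht h i m c d : height h -> gmove i h m c d -> height (flip c d h).
Proof.
move=> hh; case=> [{}c _ _|? ?|p ? ? e|r ? ? e].
- have [s [t ht]] := hh; split=> [x|]; last by exists t => x; rewrite !flipK.
  by rewrite /step !flipK; exact: s.
- exact: height_flip.
- by apply: height_flip => //; have [] := exc_step hh e.
- by apply: height_flip => //; have [] := exc_step hh e.
Qed.

Lemma completes_shift h i j s c d c2 d2 k l :
  completes h i (j + k * n%:Z) s c d (c2 + l * n%:Z) (d2 + l * n%:Z) ->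
  completes h i j s c d c2 d2.
Proof.
move=> [m' [c' [d' [m'' [c'' [d'' [[k' g'] g'' ms E]]]]]]].
exists m', c', d', m'', c'', d''; split=> //.
  by exists (k + k'); have -> : j + (k + k') * n%:Z = j + k * n%:Z + k' * n%:Z by lia.
by move=> x; rewrite -E flip_shift.
Qed.

Ltac nc H := let k := fresh in move=> k; move: (H k); lia.

(** Only an excursion starting or ending within the peak could destroy it. If one ends with the step
    [i + 1], then the up-step [i] starts at its base level, so the excursion is the peak itself and
    begins at [i - 1]; the mirror argument covers a start with the step [i]. Both are excluded
    because [j] is not adjacent to [i]. *)
Lemma max_apart h i j m c d : height h -> apart i j ->
  step h i = 1 -> step h (i + 1) = - 1 -> gmove j h m c d ->
  step (flip c d h) i = 1 /\ step (flip c d h) (i + 1) = - 1.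
Proof.
move=> hh [ij1 ij2 ij3] mi mi1; case=> [{}c _ _|j0 j1|p j0 j1 e|r j0 j1 e].
- by rewrite /step !flipK.
- by rewrite !step_flip_out //; [nc ij2|nc ij1].
- have [s1 s2] := exc_step hh e; rewrite !step_flip_out //.
  + by nc ij2.
  + move=> k Ek; have Es : step h (p - 1) = 1.
      by have -> : p - 1 = i + (- k) * n%:Z by [lia]; rewrite step_shift.
    have [jp ep gt] := e; have := gt (p - 2).
    have -> : p - 2 = p - 1 - 1 by lia.
    have : j <> p - 2 by move: (ij3 k); lia.
    have : p <> j + 1 by move=> E; move: s2; rewrite E j1.
    by rewrite !(height_pred h); lia.
  + by apply: (noncong_step hh); rewrite mi s2.
- have [s1 s2] := exc_step hh e; rewrite !step_flip_out //.
  + by apply: (noncong_step hh); rewrite mi1 s1.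
  + by nc ij1.
  + move=> k Ek; have Es : step h (r + 1 + 1) = -1.
      by have -> : r + 1 + 1 = i + 1 + (- k) * n%:Z by [lia]; rewrite step_shift.
    have [rj er gt] := e; have := gt (r + 1 + 1).
    have : j <> r + 2 by move: (ij1 k); lia.
    have : j <> r + 1 by move=> E; move: s1; rewrite -E j0.
    by rewrite !(height_succ h); lia.
Qed.

Lemma congP x y : (exists k : int, x = y + k * n%:Z) \/ noncong x y.
Proof.
case: (boolP (n%:Z %| x - y)%Z) => [/dvdzP[k E]|nd]; first by left; exists k; lia.
by right=> k E; case/negP: nd; apply/dvdzP; exists k; lia.
Qed.

Ltac apt ij := let k := fresh "k" in intro k; 
  generalize (apart_sym ij); generalize ij;
  move=> [/(_ k) ? /(_ k) ? /(_ k) ?] [/(_ k) ? /(_ k) ? /(_ k) ?]; lia.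

(** The last hypothesis leaves out a [j] between two down-steps; [gmove_commute] obtains that case
    by reflection. *)
Lemma completes_min h i j m c d : height h -> apart i j ->
    step h i = -1 -> step h (i + 1) = 1 -> gmove j (flip (i + 1) i h) m c d ->
    step h j = 1 \/ step h (j + 1) = 1 ->
  completes h i j m (i + 1) i c d.
Proof.
move=> hh ij mi mi1 gj tj.
have hu : height (flip (i + 1) i h) by exact: height_flip.
have uj : step (flip (i + 1) i h) j = step h j by rewrite step_flip_out //; apt ij.
have uj1 : step (flip (i + 1) i h) (j + 1) = step h (j + 1) by rewrite step_flip_out //; apt ij.
case: gj uj uj1 => [{}c -> -> uj uj1|-> -> uj uj1|p s0 s1 e uj uj1|r -> ->]; last by lia.
- exists true, j, j, false, (i + 1), i; split=> //; first by apply/gmove_id/gmax.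
    by apply/gmove_id/gmin; rewrite /step !flipK.
  by move=> x; rewrite /flip; lia.
- exists false, (j + 1), j, false, (i + 1), i; split=> //; first by apply/gmove_id/gmin.
    by apply/gmove_id/gmin; rewrite step_flip_out //; apt ij.
  by move=> x; rewrite /flip; lia.
have [e1 e2] := exc_step hu e.
have len : p - j < n%:Z by apply: (exc_lt_n hu e); left.
have pi : noncong p i.
  apply: (noncong_step hu); rewrite e2 step_flip_d ?mi //.
  by apply: (noncong_step hh); lia.
have [||ej|[k [e3 e4]]] := exc_of_raise hh len e _ pi; try by apt ij.
- have pi1 : noncong p (i + 1) by apply: (noncong_step hh); have [_ ->] := exc_step hh ej; lia.
  exists false, (j + 1), p, false, (i + 1), i; split=> //.
  + by apply/gmove_id/gup => //; lia.
  + by apply/gmove_id/gmin; rewrite step_flip_out //; first [exact: noncong_sym | apt ij].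
  + by move=> x; rewrite /flip; lia.
(* The raise at [i] had joined two excursions of [h] that meet at [i']. Without it, g_j lowers the
   left one, which puts [i'] between two up-steps, and g_i then lowers the right one. *)
set i' := i + k * n%:Z in e3 e4.
have ii' : i' + 1 = i + 1 + k * n%:Z by rewrite /i'; lia.
have si : step h i' = -1 by rewrite step_shift.
have si1 : step h (i' + 1) = 1 by rewrite ii' step_shift.
have [ji _] := e3; have [ip _] := e4.
have ij' : apart i' j by exact: apart_shiftl.
exists false, (j + 1), i', false, (i' + 1), p; split=> //.
- by apply/gmove_id/gup => //; lia.
- exists k; apply: gup => //.
  + rewrite step_flip_d ?si //; apt ij'.
  + rewrite step_flip_out //; first by apt ij'.
    by apply: noncong_small; lia.
  + apply: exc_lower => //; first by lia.
      by move=> l; have := muln_cases l; lia.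
    by move=> l; have := muln_cases l; lia.
- by move=> x; rewrite /flip ii' !quo_shift; lia.
Qed.

(** [r] is the last visit to the level [h j] before [j]. The scan goes leftwards from [j] and stops
    at [a] at the latest, since [a] has that level. *)
Lemma last_exc h a j : a < j -> h a = h j -> (forall y, a < y < j -> h j <= h y) ->
  exists2 r, a <= r & exc h r j.
Proof.
move=> aj eaj ge.
have scan (l : nat) : a <= j - l%:Z -> (exists2 r, a <= r & exc h r j) \/
    (forall y, j - l%:Z <= y < j -> h j < h y).
  elim: l => [|l IH] al; first by right=> y; lia.
  have [|ex|gt] := IH; [by lia|by left|].
  have [E|ne] := eqVneq (h (j - l.+1%:Z)) (h j).
    left; exists (j - l.+1%:Z) => //; split; rewrite ?E //; first by lia.
    by move=> y hy; apply: gt; lia.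
  right=> y hy; have [->|ney] := eqVneq y (j - l.+1%:Z); last by apply: gt; lia.
  have [Ea|nea] := eqVneq a (j - l.+1%:Z); first by move: ne; rewrite -Ea eaj eqxx.
  by have := ge (j - l.+1%:Z); lia.
have [|//|gt] := scan `|j - a|%N; first by lia.
by have := gt a; rewrite eaj; lia.
Qed.

(** * Commutation when g_i lowers the excursion starting at i *)

Section Up.
Variables (h : int -> int) (i p : int).
Hypotheses (hh : height h) (si : step h i = 1) (si1 : step h (i + 1) = 1) (eip : exc h i p).
Local Notation u := (flip (i + 1) p h).

Let sp : step h p = -1. Proof. by have [] := exc_step hh eip. Qed.
Let nip : noncong i p. Proof. by apply: (noncong_step hh); rewrite si sp. Qed.
Let ni1p : noncong (i + 1) p. Proof. by apply: (noncong_step hh); rewrite si1 sp. Qed.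
Let hu : height u. Proof. exact: height_flip. Qed.
Let len' : i < p < i + n%:Z.
Proof. by have := exc_lt_n hh eip (or_introl si); case: eip; lia. Qed.
Let len : i < p <= i + n%:Z. Proof. by lia. Qed.
Let ui : step u i = 1.
Proof. by rewrite step_flip_out //; apply: noncong_small; lia. Qed.
Let ui1 : step u (i + 1) = -1.
Proof. by rewrite step_flip_c // si1. Qed.
Let up : step u p = 1.
Proof. by rewrite step_flip_d // sp. Qed.
Let u_ends k : u (i + k * n%:Z) = h (i + k * n%:Z) /\ u (p + k * n%:Z) = h (p + k * n%:Z).
Proof. by split; apply: lower_out => // l; have := muln_cases (l - k); lia. Qed.

(** Here [j] is the end [p] of the excursion. Seen from [h], either [p] lies on a descending slope
    and g_p lowers the same excursion, after which g_i meets a peak; or [p] is a valley between two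
    excursions, and g_p fills it so that g_i lowers their union. *)
Lemma completes_up_end m c d : apart i p -> gmove p u m c d ->
  completes h i p m (i + 1) p c d.
Proof.
move=> ip; have sp1 : step u (p + 1) = step h (p + 1).
  by rewrite step_flip_out //; [apt ip|apply: noncong_small; lia].
case=> [{}c s0 s1|s0 s1|r s0 s1 e|r s0 s1 e]; try by move: s0; rewrite up; lia.
  exists false, (i + 1), p, true, c, c; split=> //.
    by apply/gmove_id/gdn => //; rewrite -sp1.
  exact/gmove_id/gmax.
have rp : r - p < n%:Z by apply: (exc_lt_n hu e); left.
have [pr er gt] := e.
have [uI _] := u_ends 1; have [_ up0] := u_ends 0.
rewrite !mul1r !mul0r !addr0 in uI up0.
have [_ epi gip] := eip.
(* Beyond [i + n], the point [r] would lie in the next lowered stretch, where [u] is at least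
   [h (i + n) - 1]. But [u] takes this value at [i + n - 1], strictly inside the excursion ending at
   [r]. *)
have rI : r <= i + n%:Z.
  rewrite leNgt; apply/negP => Ir.
  have := gt (i + n%:Z - 1).
  have -> : u (i + n%:Z - 1) = h (i + n%:Z) - 1.
    by rewrite height_pred uI; have := step_shift i 1 hu; rewrite mul1r ui => ->.
  have : p <> i + n%:Z - 1 by case: ip => _ _ /(_ (-1)); lia.
  have := @lower_in h i p 1 r len; rewrite mul1r => /(_ _) ur.
  have [_ _ gI] := exc_shift 1 hh eip; have := gI r; rewrite mul1r.
  by rewrite er up0 in ur; lia.
have uy y : p <= y <= r -> u y = h y.
  by move=> hy; apply: lower_out => // k; have := muln_cases k; have := muln_cases (k - 1); lia.
have epr : exc h p r.
  split=> //; first by rewrite -!uy //; lia.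
  by move=> y hy; rewrite -!uy; try lia; apply: gt.
have uyp y : h y <= flip (p + 1) p h y by exact: raise_ge.
have upp : h p < flip (p + 1) p h p.
  by have [[k _ ->]|[/(_ 0)]] := raiseP h p p; lia.
exists false, (p + 1), p, false, (i + 1), r; split=> //.
- by apply/gmove_id/gmin; rewrite -?sp1.
- apply/gmove_id/gup; try by rewrite step_flip_out //; apt ip.
  split; first by lia.
    rewrite !raise_out //; last by apply: noncong_small; lia.
    by case: epr => _ ->.
  move=> y hy; rewrite raise_out //; have := uyp y; have [_ _ gpr] := epr.
  have := gip y; have := gpr y; have [->|ne] := eqVneq y p; lia.
- by move=> x; rewrite /flip; lia.
Qed.

Lemma completes_up_pred j m c d : p = j + 1 -> apart i j -> gmove j u m c d ->
  completes h i j m (i + 1) p c d.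
Proof.
move=> pj ij; have [ip ep gip] := eip.
have inj : i + 1 < j by case: (ij) => _ /(_ 0) ? /(_ 0) ?; case: (apart_sym ij) => _ _ /(_ 0); lia.
have uj : step u j = step h j by rewrite step_flip_out //; [apt ij|apply: noncong_small; lia].
have uj1 : step u (j + 1) = 1 by rewrite -pj.
have hj1 : step h (j + 1) = -1 by rewrite -pj.
have hj : h j = h i + 1 by have := height_succ h j; rewrite -pj ep sp; lia.
case=> [{}c s0 s1|s0 s1|r s0 s1 e|r s0 s1 e]; try by move: s1; rewrite uj1; lia.
- rewrite uj in s0.
  (* In [h], g_j lowers the excursion from [r] to [j], at level [h i + 1]. This brings [r + 1] down
     to the level of [i], so the excursion of [i] now ends at [r + 1]. *)
  have [|||r ir erj] := @last_exc h (i + 1) j.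
  + by lia.
  + by rewrite height_succ si1.
  + by move=> y hy; have := gip y; lia.
  have [rj er grj] := erj; have [sr1 _] := exc_step hh erj.
  have r1j : r + 1 < j by have [E|] := eqVneq j (r + 1); [move: sr1; rewrite -E s0|]; lia.
  have win : r < j <= r + n%:Z by lia.
  have out y : i <= y <= r -> flip (r + 1) j h y = h y.
    by move=> hy; apply: lower_out => // k; have := muln_cases k; lia.
  exists false, (r + 1), j, false, (i + 1), (r + 1); split=> //.
  + exact/gmove_id/gdn.
  + apply/gmove_id/gup; try by rewrite step_flip_out //; first [apt ij|apply: noncong_small; lia].
    split; first by lia.
      rewrite (@lower_in h r j 0) //; last by lia.
      by rewrite out ?(height_succ h r) ?sr1; lia.
    by move=> y hy; rewrite !out; try lia; apply: gip; lia.
  + by move=> x; rewrite /flip pj; lia.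
- have := gip (j - 1); rewrite uj in s0; rewrite height_pred s0; lia.
Qed.

(** Such an excursion never crosses the boundary of a lowered stretch. Leaving one, it would meet a
    translate of [p], at most as high in [u] as its start; entering one, a translate of [i - 1], at
    most as high in [u] as its end. *)
Let exc_of_lower_up j r : apart i j -> step h j = 1 -> step u j = 1 -> exc u j r -> exc h j r.
Proof.
move=> ij sj suj e; have [jr er gt] := e; have [_ ur] := exc_step hu e.
have rp : noncong r p by apply: (noncong_step hu); rewrite ur up.
have [[k jk fj]|[jk fj]] := lowerP h j len.
  have ek := exc_shift k hh eip; have [_ epk gk] := ek.
  have rk : r < p + k * n%:Z.
    rewrite ltNge; apply/negP => le; have [_ uk] := u_ends k.
    have := gt (p + k * n%:Z); rewrite uk fj epk.
    have := gk (j - 1); rewrite height_pred sj; have := rp k.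
    by have : j <> i + k * n%:Z + 1 by [case: (apart_sym ij) => _ _ /(_ k); lia]; lia.
  split=> //; first by move: er; rewrite fj (@lower_in h i p k) //; lia.
  by move=> y hy; have := gt y hy; rewrite fj (@lower_in h i p k) //; lia.
have [[k rk fr]|[_ fr]] := lowerP h r len; last first.
  split; rewrite -?fj ?er //; first by rewrite -fr.
  by move=> y hy; have := gt y hy; have := lower_le h y len; lia.
have [_ _ gk] := exc_shift k hh eip; have [uk _] := u_ends k.
have := gt (i + k * n%:Z - 1); rewrite height_pred uk step_shift // ui.
have := gk r rk; have := jk k; case: (ij) => _ /(_ (- k)) ? /(_ (- k)).
by case: (apart_sym ij) => /(_ k); lia.
Qed.

(** Both steps at [j] go the same way, and when a translate of [j] is nested in the excursion of
    [i], so is its lower neighbour. Hence its height is at least [h i + 2], the depth that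
    [exc_lower] asks for. *)
Let exc_lower_apart a b j : apart i j -> exc h a b -> b - a <= n%:Z ->
    a = j \/ b = j -> noncong j p -> noncong (j + 1) p ->
    step h j = step h (j + 1) -> exc (flip (a + 1) b h) i p.
Proof.
move=> ij eab lab aj jp j1p sj; have [ip ep gip] := eip.
have [sa sb] := exc_step hh eab; apply: exc_lower => //.
  by move=> k [] Ea Eb; case: aj => E; [case: (ij) => _ /(_ k)|have := jp (- k)]; lia.
move=> k; have [_ ebk _] := exc_shift k hh eab; have [abk _ _] := exc_shift k hh eab.
case: aj => E; rewrite E in abk ebk sa sb * => lo hi.
  have := gip (j + k * n%:Z - 1); rewrite (height_pred h) step_shift // sj sa.
  by case: (ij) => _ _ /(_ k); case: (apart_sym ij) => _ _ /(_ (- k)); lia.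
have E1 : j + k * n%:Z + 1 = j + 1 + k * n%:Z by lia.
have := gip (j + k * n%:Z + 1); rewrite (height_succ h) E1 step_shift // -sj sb.
by have := j1p (- k); lia.
Qed.

Lemma completes_up_out j m c d : apart i j -> noncong j p -> noncong (j + 1) p ->
  gmove j u m c d -> completes h i j m (i + 1) p c d.
Proof.
move=> ij jp j1p.
have uj : step u j = step h j by rewrite step_flip_out //; apt ij.
have uj1 : step u (j + 1) = step h (j + 1) by rewrite step_flip_out //; apt ij.
case=> [{}c s0 s1|s0 s1|r s0 s1 e|r s0 s1 e].
- exists true, j, j, false, (i + 1), p; split=> //.
  + by apply/gmove_id/gmax; rewrite -?uj -?uj1.
  + have E : h =1 flip j j h by move=> x; rewrite flipK.
    by apply: gmove_id; apply: gmove_eq1 E _; apply: gup.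
  + by move=> x; rewrite /flip; lia.
- exists false, (j + 1), j, false, (i + 1), p; split=> //.
  + by apply/gmove_id/gmin; rewrite -?uj -?uj1.
  + apply/gmove_id/gup; try by rewrite step_flip_out //; apt ij.
    by apply: exc_raise => //; [apt ij|exact: noncong_sym].
  + by move=> x; rewrite /flip; lia.
- have ejr : exc h j r by apply: exc_of_lower_up => //; rewrite -uj.
  have [_ sr] := exc_step hh ejr.
  have lr : r - j < n%:Z by apply: (exc_lt_n hh ejr); left; rewrite -uj.
  exists false, (j + 1), r, false, (i + 1), p; split=> //.
  + by apply/gmove_id/gup; rewrite -?uj -?uj1.
  + apply/gmove_id/gup; rewrite ?step_flip_out //.
    all: try by apt ij.
    all: try by apply: (noncong_step hh); rewrite sr ?si ?si1.
    by apply: (exc_lower_apart ij ejr) => //; [lia|left|rewrite -uj -uj1 s0].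
  + by move=> x; rewrite /flip; lia.
have [rj er gt] := e; have [ur1 _] := exc_step hu e.
have lr : j - r < n%:Z by apply: (exc_lt_n hu e); right.
have finish : exc h r j -> completes h i j false (i + 1) p (r + 1) j.
  move=> erj; exists false, (r + 1), j, false, (i + 1), p; split=> //.
  - by apply/gmove_id/gdn; rewrite -?uj -?uj1.
  - apply/gmove_id/gup; rewrite ?step_flip_out //.
    all: try by apt ij.
    + move=> k Ek; have ur2 : step u (r + 1 + 1) = -1.
        by have -> : r + 1 + 1 = i + 1 + (- k) * n%:Z by [lia]; rewrite step_shift.
      have := gt (r + 1 + 1); rewrite !(height_succ u) ur1 ur2.
      have : j <> r + 1 by move=> E; move: ur1; rewrite -E s0.
      by case: (ij) => /(_ k); lia.
    + by apply: (noncong_step hu); rewrite ui1 ur1.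
    + by apply: (exc_lower_apart ij erj) => //; [lia|right|rewrite -uj -uj1 s0].
  - by move=> x; rewrite /flip; lia.
have ji k : j <> i + k * n%:Z + 1 by case: (apart_sym ij) => _ _ /(_ k); lia.
have [[k jk fj]|[jk fj]] := lowerP h j len.
  have [_ _ gk] := exc_shift k hh eip; have [uk _] := u_ends k.
  have uk1 : u (i + k * n%:Z + 1) = h (i + k * n%:Z) - 1.
    rewrite (height_succ u) uk; have -> : i + k * n%:Z + 1 = i + 1 + k * n%:Z by lia.
    by rewrite step_shift // ui1.
  have rk : i + k * n%:Z < r.
    have := gt (i + k * n%:Z + 1); rewrite uk1; have := gk j jk; have := ji k.
    have [E|] := eqVneq r (i + k * n%:Z); last by lia.
    by rewrite E uk in er *; lia.
  apply: finish; split=> //; first by move: er; rewrite fj (@lower_in h i p k) //; lia.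
  by move=> y hy; have := gt y hy; rewrite !(@lower_in h i p k) //; lia.
have [[k rk fr]|[_ fr]] := lowerP h r len; last first.
  apply: finish; split=> //; first by rewrite -fr -er fj.
  by move=> y hy; have := gt y hy; have := lower_le h y len; lia.
(* The excursion of [u] starts in a lowered stretch and ends outside it. It then starts just before
   [p'], and in [h] it extends back to [i' - 1]. Lowering that longer excursion makes [i'] a valley,
   which g_i raises. *)
set i' := i + k * n%:Z in rk; set p' := p + k * n%:Z in rk.
have [_ epk gk] := exc_shift k hh eip; have [_ uk] := u_ends k.
rewrite -/i' -/p' in epk gk uk.
have pj : p' < j by have := jp k; have := jk k; lia.
have up' : step u p' = 1 by rewrite step_shift.
have si' : step h i' = 1 by rewrite step_shift.
have ii1 : i' + 1 = i + 1 + k * n%:Z by rewrite /i'; lia.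
have si1' : step h (i' + 1) = 1 by rewrite ii1 step_shift.
have hr : h r = h i' + 1 by have := gt p'; have := gk r rk; lia.
have rp : r + 1 = p'.
  have := gt (p' - 1); rewrite height_pred uk up'; lia.
have eij : exc h (i' - 1) j.
  split; first by lia.
    by rewrite height_pred si'; lia.
  move=> y hy; rewrite height_pred si'.
  have [->|n1] := eqVneq y i'; first by lia.
  have [->|n2] := eqVneq y p'; first by lia.
  by have := gk y; have := gt y; have := lower_le h y len; lia.
have [nij0 nij _] := apart_shiftl k ij; rewrite -/i' in nij0 nij.
have ni1j : noncong (i' + 1) j by nc nij0.
have nii : noncong (i' + 1) i' by apply: noncong_small; lia.
have E1 : i' - 1 + 1 = i' by lia.
exists false, i', j, false, (i' + 1), i'; split=> //.
- by apply: gmove_id; rewrite -[X in gmove _ _ _ X _]E1; apply: gdn; rewrite -?uj -?uj1.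
- exists k; apply: gmin; first by rewrite step_flip_c // si'.
  by rewrite step_flip_out.
- by move=> x; rewrite /flip rp ii1 !quo_shift; lia.
Qed.

Lemma completes_up j m c d : apart i j -> gmove j u m c d ->
  completes h i j m (i + 1) p c d.
Proof.
move=> ij g; have [[k E]|jp] := congP p j.
  apply: (@completes_shift _ _ _ _ _ _ _ _ k k).
  have gk := gmove_shift k hu g; move: gk; rewrite -E.
  by apply: completes_up_end; rewrite E; apply/apart_sym/apart_shiftl/apart_sym.
have [[k E]|j1p] := congP p (j + 1).
  apply: (@completes_shift _ _ _ _ _ _ _ _ k k).
  apply: completes_up_pred; [lia| |exact: gmove_shift].
  exact/apart_sym/apart_shiftl/apart_sym.
by apply: completes_up_out => //; exact: noncong_sym.
Qed.

End Up.

(* The reflection of the path exchanges excursions to the left and to the right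
   of a point, which halves the case analysis. *)
Definition mirror h x := h (- x).

Lemma step_mirror h x : step (mirror h) x = - step h (1 - x).
Proof.
rewrite /step /mirror; have -> : - (x - 1) = 1 - x by lia.
have -> : 1 - x - 1 = - x by lia.
by lia.
Qed.

Lemma mirrorK h : mirror (mirror h) =1 h.
Proof. by move=> x; rewrite /mirror opprK. Qed.

Lemma height_mirror h : height h -> height (mirror h).
Proof.
move=> hh; have [s _] := hh; split=> [x|].
  by rewrite step_mirror; have := s (1 - x); lia.
have [t ht] := height_shift (-1) hh; exists t => x; rewrite /mirror -ht.
by congr h; lia.
Qed.

Lemma exc_mirror h a b : exc h a b -> exc (mirror h) (- b) (- a).
Proof.
move=> [ab e gt]; split; rewrite /mirror ?opprK //; first by lia.
by move=> y hy; rewrite e; apply: gt; lia.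
Qed.

(** The step into [x] becomes the step into [1 - x] with the opposite sign, so the two flipped steps
    exchange roles. *)
Lemma flip_mirror h c d : mirror (flip c d h) =1 flip (1 - d) (1 - c) (mirror h).
Proof.
move=> x; rewrite /mirror /flip.
have E y : quo y (- x) = - 1 - quo (1 - y) x.
  rewrite /quo; set A := x - (1 - y); have -> : - x - y = - A - 1 by lia.
  have n0 : n%:Z != 0 by lia.
  have := divz_eq A n%:Z; have := modz_ge0 A n0; have := ltz_mod A n0.
  set qA := (A %/ _)%Z; set rA := (A %% _)%Z => lt ge ->.
  have -> : - (qA * n%:Z + rA) - 1 = (- 1 - qA) * n%:Z + (n%:Z - 1 - rA) by lia.
  by rewrite divzMDl // divz_small ?addr0 //; lia.
by rewrite !E; lia.
Qed.

Lemma gmove_mirror h i m c d : height h -> gmove i h m c d ->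
  gmove (- i) (mirror h) m (1 - d) (1 - c).
Proof.
move=> hh.
have s0 : step (mirror h) (- i) = - step h (i + 1) by rewrite step_mirror; congr (- step h _); lia.
have s1 : step (mirror h) (- i + 1) = - step h i by rewrite step_mirror; congr (- step h _); lia.
case=> [{}c t0 t1|t0 t1|p t0 t1 e|r t0 t1 e].
- by apply: gmax; rewrite ?s0 ?s1 ?t0 ?t1.
- have -> : 1 - i = - i + 1 by lia.
  have -> : 1 - (i + 1) = - i by lia.
  by apply: gmin; rewrite ?s0 ?s1 ?t0 ?t1.
- have -> : 1 - p = - p + 1 by lia.
  have -> : 1 - (i + 1) = - i by lia.
  by apply: gdn; rewrite ?s0 ?s1 ?t0 ?t1 //; apply: exc_mirror.
- have -> : 1 - i = - i + 1 by lia.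
  have -> : 1 - (r + 1) = - r by lia.
  by apply: gup; rewrite ?s0 ?s1 ?t0 ?t1 //; apply: exc_mirror.
Qed.

Lemma apart_mirror i j : apart i j -> apart (- i) (- j).
Proof.
by case=> H1 H2 H3; split=> k; [move: (H3 (- k))|move: (H2 (- k))|move: (H1 (- k))]; lia.
Qed.

Lemma gmove_mod_mirror h i m c d : height h -> gmove_mod (- i) (mirror h) m c d ->
  gmove_mod i h m (1 - d) (1 - c).
Proof.
move=> hh [k g]; exists (- k).
have := gmove_mirror (height_mirror hh) g.
have -> : - (- i + k * n%:Z) = i + - k * n%:Z by lia.
exact/gmove_eq1/mirrorK.
Qed.

Lemma gmove_mod_ht h i m c d : height h -> gmove_mod i h m c d -> height (flip c d h).
Proof. by move=> hh [k g]; apply: gmove_ht g. Qed.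

Lemma gmove_mod_eq1 h h' i m c d : h =1 h' -> gmove_mod i h m c d -> gmove_mod i h' m c d.
Proof. by move=> E [k g]; exists k; apply: gmove_eq1 g. Qed.

Lemma completes_mirror h i j s c d c2 d2 : height h ->
  completes (mirror h) (- i) (- j) s (1 - d) (1 - c) (1 - d2) (1 - c2) ->
  completes h i j s c d c2 d2.
Proof.
move=> hh [m' [c' [d' [m'' [c'' [d'' [g' g'' ms E]]]]]]].
have hm := height_mirror hh.
have g1 := gmove_mod_mirror hh g'.
have Em : flip c' d' (mirror h) =1 mirror (flip (1 - d') (1 - c') h).
  by move=> x; rewrite flip_mirror /flip !subKr.
exists m', (1 - d'), (1 - c'), m'', (1 - d''), (1 - c''); split=> //.
  apply: gmove_mod_mirror; first exact: gmove_mod_ht g1.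
  exact: gmove_mod_eq1 Em g''.
have dbl a b a2 b2 : flip a2 b2 (flip a b h) =1
    mirror (flip (1 - b2) (1 - a2) (flip (1 - b) (1 - a) (mirror h))).
  move=> x; rewrite -[LHS]/(flip a2 b2 (flip a b h) x) -(mirrorK (flip a2 b2 (flip a b h)) x).
  rewrite {1}/mirror flip_mirror /mirror -/(mirror _ _).
  by apply: flip_eq1 => y; rewrite -flip_mirror.
by move=> x; rewrite dbl dbl /mirror E !subKr.
Qed.

(** Peaks, valleys and excursions to the right of [i] are treated directly. Reflection supplies the
    excursions to the left of [i], and the valleys at [i] when [j] is on a descending slope. *)
Theorem gmove_commute h i j m c d m2 c2 d2 : height h -> apart i j ->
  gmove i h m c d -> gmove j (flip c d h) m2 c2 d2 ->
  completes h i j (m + m2) c d c2 d2.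
Proof.
move=> hh ij g g2; have hu := gmove_ht hh g.
case: g g2 hu => [{}c s0 s1|s0 s1|p s0 s1 e|r s0 s1 e] g2 hu.
- have g2' : gmove j h m2 c2 d2 by apply: gmove_eq1 g2; apply: flipK.
  have [t0 t1] := max_apart hh ij s0 s1 g2'.
  exists m2, c2, d2, true, c, c; split; first exact: gmove_id.
  + exact/gmove_id/gmax.
  + by rewrite addnC.
  + by move=> x; rewrite /flip; lia.
- have tj : (step h j = 1 \/ step h (j + 1) = 1) \/ (step h j = -1 /\ step h (j + 1) = -1).
    by have [s _] := hh; have := s j; have := s (j + 1); lia.
  case: tj => [tj|[tj tj1]]; first exact: completes_min.
  apply: completes_mirror => //; have -> : 1 - i = - i + 1 by lia.
  have -> : 1 - (i + 1) = - i by lia.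
  apply: completes_min; first exact: height_mirror.
  + exact: apart_mirror.
  + by rewrite step_mirror; have -> : 1 - - i = i + 1 by [lia]; rewrite s1.
  + by rewrite step_mirror; have -> : 1 - (- i + 1) = i by [lia]; rewrite s0.
  + have := gmove_mirror hu g2; apply: gmove_eq1 => x; rewrite flip_mirror.
    have -> : 1 - i = - i + 1 by lia.
    by have -> : 1 - (i + 1) = - i by lia.
  + by left; rewrite step_mirror; have -> : 1 - - j = j + 1 by [lia]; rewrite tj1.
- exact: completes_up.
- apply: completes_mirror => //; have -> : 1 - i = - i + 1 by lia.
  have -> : 1 - (r + 1) = - r by lia.
  apply: completes_up; first exact: height_mirror.
  + by rewrite step_mirror; have -> : 1 - - i = i + 1 by [lia]; rewrite s1.
  + by rewrite step_mirror; have -> : 1 - (- i + 1) = i by [lia]; rewrite s0.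
  + exact: exc_mirror.
  + exact: apart_mirror.
  + have := gmove_mirror hu g2; apply: gmove_eq1 => x; rewrite flip_mirror.
    have -> : 1 - i = - i + 1 by lia.
    by have -> : 1 - (r + 1) = - r by lia.
Qed.

(** * Uniqueness of g_i, its image, and adjacent indices *)

Lemma exc_inj_r h a b b' : exc h a b -> exc h a b' -> b = b'.
Proof.
move=> [ab e gt] [ab' e' gt'].
by have := gt b'; have := gt' b; lia.
Qed.

Lemma exc_inj_l h a a' b : exc h a b -> exc h a' b -> a = a'.
Proof.
move=> [ab e gt] [ab' e' gt'].
by have := gt a'; have := gt' a; lia.
Qed.

Lemma gmove_fun h i m c d m' c' d' : gmove i h m c d -> gmove i h m' c' d' ->
  m = m' /\ flip c d h =1 flip c' d' h.
Proof.
case=> [{}c s0 s1|s0 s1|p s0 s1 e|r s0 s1 e];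
  case=> [{}c' t0 t1|t0 t1|p' t0 t1 e'|r' t0 t1 e']; try by exfalso; lia.
- by split=> // x; rewrite !flipK.
- by split.
- by rewrite (exc_inj_r e e').
- by rewrite (exc_inj_l e e').
Qed.

Lemma gmove_steps h i c d : height h -> gmove i h false c d -> step h c = 1 /\ step h d = -1.
Proof.
move=> hh; move E : false => m g; case: g E => [//|s0 s1|p s0 s1 e|r s0 s1 e] _ //.
  by have [_ ->] := exc_step hh e.
by have [-> _] := exc_step hh e.
Qed.

Lemma gmove_is_max h i m c d : height h -> gmove i h m c d ->
  step (flip c d h) i = 1 /\ step (flip c d h) (i + 1) = - 1.
Proof.
move=> hh; case=> [{}c s0 s1|s0 s1|p s0 s1 e|r s0 s1 e].
- by rewrite /step !flipK.
- have ni : noncong (i + 1) i by apply: noncong_small; lia.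
  by rewrite step_flip_c // step_flip_d // s0 s1.
- have [_ sp] := exc_step hh e.
  have len := exc_lt_n hh e (or_introl s0); have [ip _ _] := e.
  rewrite step_flip_c ?s1 ?step_flip_out //; first by apply: noncong_small; lia.
    by apply: noncong_small; lia.
  by apply: (noncong_step hh); rewrite sp s1.
- have [sr _] := exc_step hh e.
  have len := exc_lt_n hh e (or_intror s1); have [ri _ _] := e.
  have nri : noncong (r + 1) i by apply: (noncong_step hh); rewrite sr s0.
  rewrite step_flip_d ?s0 ?step_flip_out //; first by apply: noncong_small; lia.
  by apply: noncong_small; lia.
Qed.

(** On the peaks at [i], which are the values of g_i, the map g_i undoes g_{i+1}. If the path rises
    after [i + 1], that valley is filled and g_i lowers the excursion from [i] to [i + 2] back. If
    it keeps falling, the peak at [i] is lowered to a valley, which g_i raises again. *)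
Lemma gmove_succ_max h i : height h -> step h i = 1 -> step h (i + 1) = - 1 ->
  exists c d, gmove (i + 1) h false c d /\ gmove i (flip c d h) false d c.
Proof.
move=> hh s0 s1.
have E2 : i + 1 + 1 = i + 2 by lia.
have [s _] := hh; case: (s (i + 2)) => s2.
  have hu : height (flip (i + 2) (i + 1) h) by exact: height_flip.
  have t0 : step (flip (i + 2) (i + 1) h) i = 1.
    by rewrite step_flip_out //; apply: noncong_small; lia.
  have t1 : step (flip (i + 2) (i + 1) h) (i + 1) = 1.
    by rewrite step_flip_d ?s1 //; apply: noncong_small; lia.
  have t2 : step (flip (i + 2) (i + 1) h) (i + 2) = -1.
    by rewrite step_flip_c ?s2 //; apply: noncong_small; lia.
  exists (i + 2), (i + 1); split.
    by rewrite -[X in gmove _ _ _ X _]E2; apply: gmin; rewrite ?E2.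
  apply: gup => //; have := height_succ (flip (i + 2) (i + 1) h) i.
  have := height_succ (flip (i + 2) (i + 1) h) (i + 1); rewrite E2 t1 t2 => a1 a2.
  split; [lia|lia|move=> y hy].
  by have -> : y = i + 1 by [lia]; lia.
have t0 : step (flip i (i + 1) h) i = -1.
  by rewrite step_flip_c ?s0 //; apply: noncong_small; lia.
have t1 : step (flip i (i + 1) h) (i + 1) = 1.
  by rewrite step_flip_d ?s1 //; apply: noncong_small; lia.
exists i, (i + 1); split; last exact: gmin.
have E : i - 1 + 1 = i by lia.
rewrite -[X in gmove _ _ _ X _]E; apply: gdn; rewrite ?E2 //.
split; [lia|by rewrite (height_succ h) (height_pred h); lia|move=> y hy].
by have -> : y = i by [lia]; rewrite (height_pred h); lia.
Qed.

Lemma gmove_pred_max h i : height h -> step h i = 1 -> step h (i + 1) = - 1 ->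
  exists c d, gmove (i - 1) h false c d /\ gmove i (flip c d h) false d c.
Proof.
move=> hh s0 s1; have hm := height_mirror hh.
have [||c [d [g1 g2]]] := @gmove_succ_max (mirror h) (- i) hm.
- by rewrite step_mirror; have -> : 1 - - i = i + 1 by [lia]; rewrite s1.
- by rewrite step_mirror; have -> : 1 - (- i + 1) = i by [lia]; rewrite s0.
exists (1 - d), (1 - c); split.
  have := gmove_mirror hm g1; have -> : - (- i + 1) = i - 1 by lia.
  exact/gmove_eq1/mirrorK.
have := gmove_mirror (gmove_ht hm g1) g2; rewrite opprK; apply: gmove_eq1 => x.
by rewrite flip_mirror; apply: flip_eq1; exact: mirrorK.
Qed.

End Heights.

(** * Tableaux *)

Section Residues.
Variable n : nat.
Hypothesis n_ge3 : (3 <= n)%N.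

Lemma bar_cong (k : int) : exists z : int, (bar n k)%:Z = k + z * n%:Z.
Proof.
have n0 : n%:Z != 0 by lia.
exists (- ((k - 1) %/ n%:Z)%Z); rewrite /bar.
have := divz_eq (k - 1) n%:Z; have := modz_ge0 (k - 1) n0.
by set m := (_ %% _)%Z; set r := (_ %/ _)%Z => m0 E; lia.
Qed.

Lemma bar_itv (k : int) : (1 <= bar n k <= n)%N.
Proof.
have n0 : n%:Z != 0 by lia.
have := modz_ge0 (k - 1) n0; have := ltz_mod (k - 1) n0; rewrite /bar.
by set m := (_ %% _)%Z => ? ?; lia.
Qed.

Lemma bar_unique (a : nat) (k z : int) : (1 <= a <= n)%N -> a%:Z = k + z * n%:Z -> bar n k = a.
Proof.
move=> an ak; have := bar_itv k; have [z' E] := bar_cong k.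
have := muln_cases n_ge3 (z - z'); lia.
Qed.

Lemma bar_shift (k z : int) : bar n (k + z * n%:Z) = bar n k.
Proof.
have [z' E] := bar_cong (k + z * n%:Z).
by symmetry; apply: (@bar_unique _ _ (z + z')); [exact: bar_itv|lia].
Qed.

Lemma bar_id (a : nat) : (1 <= a <= n)%N -> bar n a%:Z = a.
Proof. by move=> an; apply: (@bar_unique _ _ 0) => //; lia. Qed.

Lemma bar_eqP (x y : int) : bar n x = bar n y -> exists k : int, x = y + k * n%:Z.
Proof.
have [z E] := bar_cong x; have [z' E'] := bar_cong y => e.
by exists (z' - z); move: E; rewrite e E'; lia.
Qed.

Lemma bar_dvd (x : int) (a : nat) : (1 <= a <= n)%N -> (n%:Z %| x - a%:Z)%Z = (bar n x == a).
Proof.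
move=> an; apply/idP/eqP => [/dvdzP[k E]|<-].
  by apply: (@bar_unique _ _ (- k)) => //; lia.
by have [z ->] := bar_cong x; apply/dvdzP; exists (- z); lia.
Qed.

Lemma noncong_bar (x y : int) : noncong n x y -> bar n x != bar n y.
Proof. by move=> H; apply/eqP => /bar_eqP[k /H]. Qed.

End Residues.

(** * Tableaux as lattice paths, interchanges as flips *)

Section Tableaux.
Variables n l1 l2 : nat.
Hypothesis n_ge3 : (3 <= n)%N.
Local Notation tab := (rsyt n l1 l2).
Implicit Types (s t u v w : tab) (i j k x y c d : int) (a b : nat).

Lemma rsytP v : [/\ sorted ltn (top_row v), sorted ltn (bot_row v)
  & perm_eq (top_row v ++ bot_row v) (iota 1 n)].
Proof. by case: v => T; rewrite /top_row /bot_row /= => /and3P[]. Qed.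

Lemma size_top v : size (top_row v) = l1. Proof. by rewrite size_map size_tuple. Qed.
Lemma size_bot v : size (bot_row v) = l2. Proof. by rewrite size_map size_tuple. Qed.

Lemma mem_rows v a : (a \in top_row v) || (a \in bot_row v) = (1 <= a <= n)%N.
Proof. by have [_ _ /perm_mem/(_ a)] := rsytP v; rewrite mem_cat mem_iota add1n ltnS. Qed.

Lemma uniq_rows v : uniq (top_row v ++ bot_row v).
Proof. by have [_ _ /perm_uniq->] := rsytP v; rewrite iota_uniq. Qed.

Lemma bot_rowE v a : (1 <= a <= n)%N -> (a \in bot_row v) = (a \notin top_row v).
Proof.
rewrite -(mem_rows v); have := uniq_rows v; rewrite cat_uniq => /and3P[_ /hasPn H _].
by case: (boolP (a \in bot_row v)) => [/H/negPf->|_] //; rewrite orbF => ->.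
Qed.

Lemma bar_bot v x : (bar n x \in bot_row v) = (bar n x \notin top_row v).
Proof. by apply: bot_rowE; apply: bar_itv. Qed.

Lemma rsyt_inj u v : top_row u =i top_row v -> u = v.
Proof.
move=> E; have [st sb _] := rsytP u; have [st' sb' _] := rsytP v.
have Et : top_row u = top_row v by apply: (irr_sorted_eq ltn_trans ltnn).
have Eb : bot_row u = bot_row v.
  apply: (irr_sorted_eq ltn_trans ltnn) => // a.
  have [an|an] := boolP (1 <= a <= n)%N; first by rewrite !bot_rowE // E.
  by move: (mem_rows u a) (mem_rows v a); rewrite (negPf an); do 2 case: (a \in bot_row _); rewrite ?orbT.
case: u v Et Eb {E st sb st' sb'} => [[u1 u2] pu] [[v1 v2] pv]; rewrite /top_row /bot_row /=.
move=> /(inj_map val_inj)/val_inj E1 /(inj_map val_inj)/val_inj E2.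
by apply: val_inj; rewrite /= E1 E2.
Qed.

Lemma rsyt_exists (r1 r2 : seq nat) : size r1 = l1 -> size r2 = l2 ->
    sorted ltn r1 -> sorted ltn r2 -> perm_eq (r1 ++ r2) (iota 1 n) ->
  exists v : tab, top_row v = r1 /\ bot_row v = r2.
Proof.
move=> z1 z2 s1 s2 p.
have val_inord r : {subset r <= r1 ++ r2} -> map val (map (@inord n) r) = r.
  move=> sub; rewrite -map_comp -[RHS]map_id; apply/eq_in_map => a /sub /=.
  by rewrite (perm_mem p) mem_iota add1n => /andP[_ an]; rewrite inordK.
have [sub1 sub2] : {subset r1 <= r1 ++ r2} /\ {subset r2 <= r1 ++ r2}.
  by split=> a ar; rewrite mem_cat ar ?orbT.
have zm1 : size (map (@inord n) r1) == l1 by rewrite size_map z1.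
have zm2 : size (map (@inord n) r2) == l2 by rewrite size_map z2.
have isT : is_rsyt (Tuple zm1, Tuple zm2) by rewrite /is_rsyt /= !val_inord // s1 s2 p.
by exists (RSYT isT); rewrite /top_row /bot_row /= !val_inord.
Qed.

(* quo n a increases by 1 exactly at the integers congruent to a. *)
Definition ht v x : int :=
  \sum_(a <- top_row v) quo n a%:Z x - \sum_(b <- bot_row v) quo n b%:Z x.

Lemma sum_quo_pred (r : seq nat) x : uniq r -> {subset r <= iota 1 n} ->
  \sum_(a <- r) quo n a%:Z x - \sum_(a <- r) quo n a%:Z (x - 1) = (bar n x \in r)%:R.
Proof.
move=> ur sub; rewrite -sumrB.
under eq_big_seq => a ar.
  have an : (1 <= a <= n)%N by have := sub a ar; rewrite mem_iota add1n ltnS.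
  rewrite /quo; have -> : x - 1 - a%:Z = x - a%:Z - 1 by lia.
  rewrite divz_pred //; rewrite opprB addrC subrK (bar_dvd n_ge3) //.
  over.
rewrite -natr_sum; congr _%:R; rewrite -(count_uniq_mem _ ur) -sum1_count [RHS]big_mkcond /=.
by apply: eq_bigr => a _; rewrite eq_sym; case: (a == _).
Qed.

Lemma step_ht v x : step (ht v) x = if bar n x \in top_row v then 1 else -1.
Proof.
have := uniq_rows v; rewrite cat_uniq => /and3P[u1 _ u2].
have sub r : r = top_row v \/ r = bot_row v -> {subset r <= iota 1 n}.
  by by move=> H a ar; rewrite mem_iota add1n ltnS -(mem_rows v); case: H ar => -> ->; rewrite ?orbT.
have := sum_quo_pred x u1 (sub _ (or_introl erefl)).
have := sum_quo_pred x u2 (sub _ (or_intror erefl)).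
rewrite bar_bot /step /ht; case: (_ \in _) => /=; lia.
Qed.

Lemma ht_height v : height n (ht v).
Proof.
split=> [x|]; first by rewrite step_ht; case: ifP; [left|right].
exists (l1%:Z - l2%:Z) => x; rewrite /ht.
have S r : \sum_(a <- r) quo n a%:Z (x + n%:Z) = \sum_(a <- r) quo n a%:Z x + (size r)%:Z.
  elim: r => [|a r IH]; first by rewrite !big_nil.
  rewrite !big_cons IH /=; have -> : quo n a%:Z (x + n%:Z) = quo n a%:Z x + 1; last by lia.
  rewrite /quo; have -> : x + n%:Z - a%:Z = 1 * n%:Z + (x - a%:Z) by lia.
  by rewrite divzMDl; lia.
by rewrite !S size_top size_bot; lia.
Qed.

Lemma top_step v x : (bar n x \in top_row v) = (step (ht v) x == 1).
Proof. by rewrite step_ht; case: ifP. Qed.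

Lemma bot_step v x : (bar n x \in bot_row v) = (step (ht v) x == -1).
Proof. by rewrite bar_bot step_ht; case: ifP. Qed.

Lemma ht_inj u v e : (forall x, ht u x = ht v x + e) -> u = v.
Proof.
move=> E; apply: rsyt_inj => a.
have [an|an] := boolP (1 <= a <= n)%N.
  by rewrite -(bar_id n_ge3 an) !top_step /step !E; congr (_ == _); lia.
by move: (mem_rows u a) (mem_rows v a); rewrite (negPf an); do 2 case: (a \in top_row _).
Qed.

Lemma swap_entriesC a b : swap_entries a b =1 swap_entries b a.
Proof. by move=> x; rewrite /swap_entries; do 2 case: eqP => // ->. Qed.

Lemma swap_entriesK a b : involutive (swap_entries a b).
Proof.
move=> x; rewrite /swap_entries; have [->|xa] := eqVneq x a.
  by rewrite eqxx; case: eqP.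
have [->|xb] := eqVneq x b; first by rewrite eqxx.
by rewrite (negPf xa) (negPf xb).
Qed.

Lemma is_interchangeC a b s t : is_interchange a b s t = is_interchange b a s t.
Proof. by rewrite /is_interchange !(eq_map (swap_entriesC a b)). Qed.

Lemma sum_swap (r : seq nat) a b x : uniq r -> a \in r -> b \notin r ->
  \sum_(z <- map (swap_entries a b) r) quo n z%:Z x
    = \sum_(z <- r) quo n z%:Z x - quo n a%:Z x + quo n b%:Z x.
Proof.
move=> ur ar br; rewrite (perm_big _ (perm_map _ (perm_to_rem ar))) (perm_big _ (perm_to_rem ar)).
rewrite /= !big_cons {1}/swap_entries eqxx big_map.
rewrite (@eq_big_seq _ _ _ _ (rem a r) _ (fun z : nat => quo n z%:Z x)) => [|c].
  by rewrite [quo n a%:Z x + _]addrC addrK addrC.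
rewrite mem_rem_uniq // inE => /andP[ca cr]; rewrite /swap_entries (negPf ca).
by case: eqP br => // <-; rewrite cr.
Qed.

Lemma swap_exists v a b : a \in top_row v -> b \in bot_row v ->
  exists u, is_interchange a b v u /\ forall x, ht u x = flip n a%:Z b%:Z (ht v) x.
Proof.
move=> at_ bb; have := uniq_rows v; rewrite cat_uniq => /and3P[u1 /hasPn dis u2].
have [_ _ p] := rsytP v.
have bt : b \notin top_row v by apply: dis.
have ab : a \notin bot_row v by apply/negP => /dis; rewrite at_.
have injsw := inv_inj (swap_entriesK a b).
have usw r : uniq r -> uniq (map (swap_entries a b) r) by rewrite map_inj_uniq.
have [|||||u [E1 E2]] := @rsyt_exists (sort leq (map (swap_entries a b) (top_row v)))
    (sort leq (map (swap_entries a b) (bot_row v))).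
- by rewrite size_sort size_map size_top.
- by rewrite size_sort size_map size_bot.
- by rewrite ltn_sorted_uniq_leq sort_uniq usw //= sort_sorted //; exact: leq_total.
- by rewrite ltn_sorted_uniq_leq sort_uniq usw //= sort_sorted //; exact: leq_total.
- apply: (@perm_trans _ (map (swap_entries a b) (top_row v ++ bot_row v))).
    by rewrite map_cat perm_cat // perm_sort.
  rewrite uniq_perm ?iota_uniq ?usw ?uniq_rows // => c.
  rewrite -{1}(swap_entriesK a b c) mem_map // (perm_mem p) !mem_iota !add1n !ltnS.
  have an : (1 <= a <= n)%N by rewrite -(mem_rows v) at_.
  have bn : (1 <= b <= n)%N by rewrite -(mem_rows v) bb orbT.
  rewrite /swap_entries; have [->|_] := eqVneq c a; first by rewrite an bn.
  by have [->|//] := eqVneq c b; rewrite an bn.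
exists u; split; first by rewrite /is_interchange E1 E2 !eqxx.
move=> x; rewrite /ht /flip E1 E2 !(perm_big _ (permEl (perm_sort _ _))) /=.
rewrite sum_swap // -(eq_map (swap_entriesC b a)) sum_swap //; ring.
Qed.

(** The entries are the residues of [c] and [d]. Reducing the two integers separately changes [flip]
    by a constant, whence [e]. *)
Lemma interchangeP u v c d : bar n c \in top_row u -> bar n d \in bot_row u ->
  is_interchange (bar n c) (bar n d) u v <->
  exists e, forall x, ht v x = flip n c d (ht u) x + e.
Proof.
move=> ct db; have [u' [iu' hu']] := swap_exists ct db.
have [zc Ec] := bar_cong n_ge3 c; have [zd Ed] := bar_cong n_ge3 d.
have hE x : ht u' x = flip n c d (ht u) x + (2 * zc - 2 * zd).
  by rewrite hu' /flip Ec Ed !quo_shift //; lia.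
split=> [iv|[e he]].
  have <- : u' = v; last by exists (2 * zc - 2 * zd).
  apply: rsyt_inj => a; move: iu' iv => /andP[/eqP E1 _] /andP[/eqP E2 _].
  by rewrite E1 E2.
have <- // : u' = v.
by apply: (@ht_inj _ _ (2 * zc - 2 * zd - e)) => x; rewrite hE he; lia.
Qed.

End Tableaux.

(** * Moves of the second kind as lowered excursions *)

Section SecondKind.
Variables n l1 l2 : nat.
Hypothesis n_ge3 : (3 <= n)%N.
Local Notation tab := (rsyt n l1 l2).
Implicit Types (s t u v w : tab) (i j x y : int).

(** The bound [L < n] matters: the full circle and the empty interval have the same endpoints, and
    [cyc_itv] reads them as empty. *)
Lemma cyc_itvE (x y : int) (L : nat) : (L < n)%N -> y = x + L%:Z - 1 ->
  cyc_itv n (bar n x) (bar n y) = traject (fun z : nat => bar n (z%:Z + 1)) (bar n x) L.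
Proof.
move=> Ln ->; rewrite /cyc_itv.
have [z Ez] := bar_cong n_ge3 x; have [z' Ez'] := bar_cong n_ge3 (x + L%:Z - 1).
have -> : bar n ((bar n (x + L%:Z - 1))%:Z + 1) = bar n (x + L%:Z).
  by rewrite Ez'; have -> : x + L%:Z - 1 + z' * n%:Z + 1 = x + L%:Z + z' * n%:Z by [lia]; rewrite bar_shift.
case: L Ln Ez' => [|L] Ln Ez'; first by rewrite addr0 eqxx.
rewrite (negPf (noncong_bar n_ge3 _)); last by apply: noncong_small => //; lia.
congr traject; apply: (@bar_unique _ n_ge3 _ _ (z - z')); lia.
Qed.

Lemma bar_succ x : bar n ((bar n x)%:Z + 1) = bar n (x + 1).
Proof.
have [z ->] := bar_cong n_ge3 x.
by have -> : x + z * n%:Z + 1 = x + 1 + z * n%:Z by [lia]; rewrite bar_shift.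
Qed.

Lemma count_bot s x (L : nat) :
  ht s (x + L%:Z) - ht s x
  = L%:Z - 2 * (count (mem (bot_row s)) (traject (fun z : nat => bar n (z%:Z + 1)) (bar n (x + 1)) L))%:Z.
Proof.
elim: L x => [|L IH] x; first by rewrite addr0 subrr.
rewrite /= bar_succ; have := IH (x + 1).
have -> : x + 1 + L%:Z = x + L.+1%:Z by lia.
have := step_ht n_ge3 s (x + 1); rewrite bar_bot // /step addrK.
by case: (_ \in top_row _) => /=; lia.
Qed.

Lemma count2E s (x y z : int) (L : nat) : (L < n)%N -> z = x - 1 -> y = z + L%:Z ->
  ht s y - ht s z = L%:Z - 2 * (count2 s (bar n x) (bar n y))%:Z.
Proof.
move=> Ln -> ->; rewrite /count2 (@cyc_itvE _ _ L) //; last by lia.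
by rewrite count_bot; have -> : x - 1 + 1 = x by lia.
Qed.

Lemma move2_at_shift i j (z z' : int) s t :
  move2_at (i + z * n%:Z) (j + z' * n%:Z) s t = move2_at i j s t.
Proof.
have B (x y k : int) : x = y + k * n%:Z -> bar n x = bar n y by move=> ->; apply: bar_shift.
rewrite /move2_at (B (i + z * n%:Z) i z) // (B (j + z' * n%:Z) j z') //.
rewrite (B (i + z * n%:Z + 1) (i + 1) z); last by lia.
rewrite (B (i + z * n%:Z - 1) (i - 1) z); last by lia.
rewrite (B (i + z * n%:Z + 2) (i + 2) z); last by lia.
rewrite (B (j + z' * n%:Z + 1) (j + 1) z'); last by lia.
rewrite (B (j + z' * n%:Z - 1) (j - 1) z'); last by lia.
rewrite (B (j + z' * n%:Z - 2) (j - 2) z'); last by lia.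
rewrite (B (j + z' * n%:Z - (i + z * n%:Z)) (j - i) (z' - z)); last by lia.
rewrite (eq_all (a2 := fun k : nat => k <= count2 s (bar n (j - 1 - 2 * k%:Z)) (bar n (j - 2)))%N) //.
by move=> k; rewrite (B (j + z' * n%:Z - 1 - 2 * k%:Z) (j - 1 - 2 * k%:Z) z') //; lia.
Qed.

Lemma ht_flip_sym s t c d e : (forall x, ht s x = flip n c d (ht t) x + e) ->
  forall x, ht t x = flip n d c (ht s) x - e.
Proof. by move=> E x; rewrite /flip E /flip; lia. Qed.

(** Counting bottom entries measures height differences, so conditions (a), (b), (d) and (e) say
    that the path of [s] from [i] to [j - 1] is a Dyck path. *)
Lemma dyck_cond s i j (d : nat) : (0 < d)%N -> (d + 2 <= n)%N -> j = i + d%:Z ->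
    step (ht s) i = -1 -> step (ht s) j = 1 ->
  [&& odd d, bar n (i + 1) \in top_row s, bar n (j - 1) \in bot_row s,
      all (fun k : nat => k <= count2 s (bar n (j - 1 - 2 * k%:Z)) (bar n (j - 2)))%N
          (iota 1 ((d - 3) %/ 2)%N)
    & (bar n j != bar n (i + 1)) ==>
        (count2 s (bar n (i + 2)) (bar n (j - 2)) == (d - 3) %/ 2)%N]
  <-> ht s (j - 1) = ht s i /\ forall y, i <= y <= j - 1 -> ht s i <= ht s y.
Proof.
move=> d0 dn ij si sj.
have [d1|d3] : (d = 1)%N \/ (2 <= d)%N by lia.
  have Ej : j = i + 1 by lia.
  rewrite Ej in sj *; rewrite d1 eqxx /= andbT; have -> : i + 1 - 1 = i by lia.
  rewrite top_step // sj bot_step // si !eqxx.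
  by split=> // _; split=> // y hy; have -> : y = i by lia.
have hss := (ht_height n_ge3 s).1.
have nij : bar n j != bar n (i + 1) by apply: noncong_bar => //; apply: noncong_small => //; lia.
have -> /= : (bar n j != bar n (i + 1)) ==>
   (count2 s (bar n (i + 2)) (bar n (j - 2)) == (d - 3) %/ 2)%N =
   (count2 s (bar n (i + 2)) (bar n (j - 2)) == (d - 3) %/ 2)%N by rewrite nij.
rewrite top_step // bot_step //.
have up_i := height_succ (ht s) i; have dn_j := height_pred (ht s) (j - 1).
have E2 : j - 1 - 1 = j - 2 by lia.
rewrite E2 in dn_j.
have Ck (k : nat) : (2 * k <= d - 2)%N -> ht s (j - 2) - ht s (j - 2 - 2 * k%:Z)
    = 2 * k%:Z - 2 * (count2 s (bar n (j - 1 - 2 * k%:Z)) (bar n (j - 2)))%:Z.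
  by move=> kd; rewrite (@count2E s (j - 1 - 2 * k%:Z) (j - 2) (j - 2 - 2 * k%:Z) (2 * k)%N) //; lia.
have Ce : (3 <= d)%N -> ht s (j - 2) - ht s (i + 1)
    = (d - 3)%N%:Z - 2 * (count2 s (bar n (i + 2)) (bar n (j - 2)))%:Z.
  by move=> d3'; rewrite (@count2E s (i + 2) (j - 2) (i + 1) (d - 3)%N) //; lia.
split.
  case/and5P=> od /eqP si1 /eqP sj1 /allP al /eqP ce.
  have d3' : (3 <= d)%N by move: od; lia.
  have e2 : ht s (j - 2) = ht s (i + 1) by have := Ce d3'; rewrite ce; lia.
  have low (k : nat) : (2 * k + 3 <= d)%N -> ht s i + 1 <= ht s (j - 2 - 2 * k%:Z).
    case: k => [|k] kd; first by have -> : j - 2 - 2 * 0%N%:Z = j - 2 by [lia]; lia.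
    have := al k.+1; rewrite mem_iota => /(_ _) le.
    have := Ck k.+1; lia.
  split; first by lia.
  move=> y hy; have [->|yi] := eqVneq y i; first by [].
  (* The counts bound the heights at the points [j - 2 - 2 * k] only, by [ht s i + 1]. A remaining
     point other than [i] and [j - 1] is one step away from such a point, hence not below
     [ht s i]. *)
  pose k := (absz (j - 1 - y)%R %/ 2)%N.
  have [E|E] : y = j - 1 - 2 * k%:Z \/ y = j - 2 - 2 * k%:Z by rewrite /k; lia.
    have [k0|k1] : k = 0%N \/ (1 <= k)%N by lia.
      have -> : y = j - 1 by lia.
      by lia.
    have := low k; have := height_succ (ht s) (j - 2 - 2 * k%:Z).
    have -> : j - 2 - 2 * k%:Z + 1 = y by lia.
    by have := hss y; lia.
  by have := low k; rewrite -E; lia.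
case=> e ge.
have := count_bot s i (d - 1)%N; have -> : i + (d - 1)%N%:Z = j - 1 by lia.
rewrite e; set c := count _ _ => Ec.
have od : odd d by lia.
have si1 : step (ht s) (i + 1) = 1 by have := ge (i + 1); have := hss (i + 1); lia.
have sj1 : step (ht s) (j - 1) = -1 by have := ge (j - 2); have := hss (j - 1); lia.
rewrite od si1 sj1 !eqxx /=; apply/andP; split.
  apply/allP => k; rewrite mem_iota => hk.
  have := Ck k; have := ge (j - 2 - 2 * k%:Z); lia.
by apply/eqP; have := Ce; lia.
Qed.

(** Read on the target [t], the Dyck path together with the interchanged steps is an excursion from
    [i - 1] to [j]. Condition (c) then says that g_{i-1} or g_j is the map that lowers it. *)
Lemma move2P s t i j (d : nat) : (0 < d <= n)%N -> j = i + d%:Z ->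
  move2_at i j s t <->
  [/\ (d + 2 <= n)%N, step (ht t) i = 1, step (ht t) j = -1,
      step (ht t) (i - 1) = 1 \/ step (ht t) (j + 1) = -1 &
      exc (ht t) (i - 1) j /\ exists e, forall x, ht s x = flip n i j (ht t) x + e].
Proof.
move=> dn ij; have Ed : bar n (j - i) = d by apply: (@bar_unique _ n_ge3 _ _ 0) => //; lia.
have E1 : i - 1 + 1 = i by lia.
have low (e y : int) : (d + 2 <= n)%N -> (forall x, ht s x = flip n i j (ht t) x + e) ->
    i <= y < j -> ht s y = ht t y - 2 + e.
  move=> dn2 E hy; rewrite E; congr (_ + e).
  by have := @lower_in n n_ge3 (ht t) (i - 1) j 0 y; rewrite E1 => -> //; lia.
have steps (e : int) : (d + 2 <= n)%N -> (forall x, ht s x = flip n i j (ht t) x + e) ->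
    [/\ step (ht s) i = step (ht t) i - 2, step (ht s) j = step (ht t) j + 2,
        step (ht s) (i - 1) = step (ht t) (i - 1) & step (ht s) (j + 1) = step (ht t) (j + 1)].
  move=> dn2 E; have nij : noncong n i j by apply: noncong_small => //; lia.
  split; rewrite (step_const _ E) ?step_flip_c ?step_flip_d ?step_flip_out //;
    by apply: noncong_small => //; lia.
have exc_iff (e : int) : (d + 2 <= n)%N -> (forall x, ht s x = flip n i j (ht t) x + e) ->
    step (ht t) i = 1 -> step (ht t) j = -1 ->
    exc (ht t) (i - 1) j <-> (ht s (j - 1) = ht s i /\ forall y, i <= y <= j - 1 -> ht s i <= ht s y).
  move=> dn2 E ti tj; have Ls y := low e y dn2 E.
  have Ti := height_pred (ht t) i; have Tj := height_pred (ht t) j.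
  split=> [[_ e1 gt]|[e1 ge]].
    split; first by rewrite !Ls; lia.
    by move=> y hy; rewrite !Ls; try lia; have := gt y; lia.
  have L1 := Ls i; have L2 := Ls (j - 1); split; try lia.
  by move=> y hy; have := ge y; have := Ls y; lia.
split.
  rewrite /move2_at Ed => /andP[bi] /andP[tj] /andP[ij1] /and5P[od ti1 bj1 cc] /and3P[al ce].
  rewrite is_interchangeC => /interchangeP - /(_ n_ge3 tj bi) [e /ht_flip_sym E].
  move: (bi) (tj); rewrite bot_step // top_step // => /eqP si /eqP sj.
  (* [d = n] would put one entry in both rows, and [d = n - 1] means that [i] and [j + 1] are
     congruent, which is excluded. *)
  have dn2 : (d + 2 <= n)%N.
    rewrite leqNgt; apply/negP => dn3; have [dn'|dn'] : d = n \/ d.+1 = n by lia.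
      move: tj; have -> : bar n j = bar n i by rewrite ij dn' -(bar_shift n_ge3 i 1) mul1r.
      by move: bi; rewrite bar_bot // => /negPf->.
    have Ej : j + 1 = i + 1 * n%:Z by lia.
    by move: ij1; rewrite Ej bar_shift // eqxx.
  have [si' sj' sc1 sc2] := steps _ dn2 E.
  have ti : step (ht t) i = 1 by lia.
  have tj' : step (ht t) j = -1 by lia.
  split=> //.
    by move: cc; rewrite top_step // bot_step // sc1 sc2 => /orP[/eqP|/eqP]; [left|right].
  split; last by exists (- e).
  apply/(exc_iff _ dn2 E) => //; apply/(dyck_cond _ dn2 ij) => //; first by lia.
  by rewrite od ti1 bj1 al ce.
case=> dn2 ti tj cc [ex [e E]]; have [si sj sc1 sc2] := steps _ dn2 E.
have si' : step (ht s) i = -1 by lia.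
have sj' : step (ht s) j = 1 by lia.
have d0 : (0 < d)%N by lia.
have bi : bar n i \in bot_row s by rewrite bot_step // si'.
have tj' : bar n j \in top_row s by rewrite top_step // sj'.
have /(dyck_cond d0 dn2 ij si' sj')/and5P[od ti1 bj1 al ce] := (exc_iff _ dn2 E ti tj).1 ex.
rewrite /move2_at Ed bi tj' od ti1 bj1 al ce /= andbA; apply/andP; split.
  apply/andP; split; first by apply: noncong_bar => //; apply: noncong_small => //; lia.
  rewrite top_step // bot_step // sc1 sc2.
  by case: cc => ->; rewrite eqxx ?orbT.
rewrite is_interchangeC; apply/interchangeP => //; exists (- e).
exact: ht_flip_sym.
Qed.

End SecondKind.

(** * Edges of the graph and the maps g_i *)

Section TableauMoves.
Variables n l1 l2 : nat.
Hypothesis n_ge3 : (3 <= n)%N.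
Local Notation tab := (rsyt n l1 l2).
Implicit Types (s t u v w : tab) (x y : int).

(* u = g_i v, and m tells whether i is a descent of v. *)
Definition tmove (i : int) v m u :=
  exists c d e, gmove_mod n i (ht v) m c d /\ forall x, ht u x = flip n c d (ht v) x + e.

Lemma desE (i : 'I_n) v :
  (i \in affine_des v) = (step (ht v) i%:Z == 1) && (step (ht v) (i%:Z + 1) == -1).
Proof. by rewrite inE top_step // bot_step. Qed.

Lemma ord_lift x : exists (o : 'I_n) (z : int), x = o%:Z + z * n%:Z.
Proof.
have n0 : n%:Z != 0 by lia.
have ge := modz_ge0 x n0; have lt : (x %% n%:Z)%Z < n%:Z by apply: ltz_pmod; lia.
have on : (absz (x %% n%:Z)%Z < n)%N by lia.
by exists (Ordinal on), (x %/ n%:Z)%Z => /=; rewrite {1}(divz_eq x n%:Z); lia.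
Qed.

(** The W-graph formula uses an edge only at an index that is a descent of the source and not of the
    target. The interchange must then change the step [i] or [i + 1], and the signs of these steps
    in [s] leave only the flip of g_i. *)
Lemma tmove_of_move (i : 'I_n) s t : i \notin affine_des t -> i \in affine_des s ->
  move s t -> tmove i%:Z t false s.
Proof.
rewrite !desE => nt /andP[/eqP si /eqP si1].
have hs := ht_height n_ge3 s; have hT := ht_height n_ge3 t.
case/orP=> [/existsP[o]|/existsP[o1 /existsP[o2]]].
  case/and3P=> to bo1 /interchangeP - /(_ n_ge3 to bo1) [e E].
  move: (to) (bo1); rewrite top_step // bot_step // => /eqP so /eqP so1.
  have no : noncong n o%:Z (o%:Z + 1) by apply: noncong_small => //; lia.
  have to0 : step (ht t) o%:Z = -1 by rewrite (step_const _ E) step_flip_c // so.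
  have to1 : step (ht t) (o%:Z + 1) = 1 by rewrite (step_const _ E) step_flip_d // so1.
  have [[k Ek]|nio] := congP n_ge3 o%:Z i%:Z.
    exists (o%:Z + 1), o%:Z, (- e); split; last exact: ht_flip_sym.
    by exists k; rewrite -Ek; apply: gmin.
  case/negP: nt; rewrite !(step_const _ E) !step_flip_out // ?si ?si1 //.
  - by apply: (noncong_step n_ge3 hs); rewrite si1 so.
  - by move=> k Ek; apply: (nio (- k)); lia.
  - exact: noncong_sym.
  - by apply: (noncong_step n_ge3 hs); rewrite si so1.
set i1 := o1%:Z; set j := i1 + (bar n (o2%:Z - o1%:Z))%:Z.
have [z Ez] : exists z : int, j = o2%:Z + z * n%:Z.
  by have [z Ez] := bar_cong n_ge3 (o2%:Z - o1%:Z); exists z; rewrite /j Ez /i1; lia.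
rewrite -(move2_at_shift n_ge3 _ _ 0 z) mul0r addr0 -Ez -/i1.
have dn := bar_itv n_ge3 (o2%:Z - o1%:Z).
case/(move2P n_ge3 _ _ dn (erefl j)) => dn2 ti tj _ [ex [e E]].
have nij : noncong n i1 j by apply: noncong_small => //; rewrite /j; lia.
have E1 : i1 - 1 + 1 = i1 by lia.
have si0 : step (ht s) i1 = -1 by rewrite (step_const _ E) step_flip_c // ti.
have sj0 : step (ht s) j = 1 by rewrite (step_const _ E) step_flip_d // tj.
have [[k Ek]|nj] := congP n_ge3 j i%:Z.
  exists (i1 - 1 + 1), j, e; rewrite {2}E1; split=> //.
  exists k; rewrite -Ek; apply: gdn => //.
  have : step (ht s) (j + 1) = -1.
    by have -> : j + 1 = i%:Z + 1 + k * n%:Z by [lia]; rewrite step_shift.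
  by rewrite (step_const _ E) step_flip_out //; apply: noncong_small => //; rewrite /j; lia.
have [[k Ek]|ni] := congP n_ge3 (i1 - 1) i%:Z.
  exists (i1 - 1 + 1), j, e; rewrite {2}E1; split=> //.
  exists k; rewrite -Ek; apply: gup; rewrite ?E1 //.
  have : step (ht s) (i1 - 1) = 1 by rewrite Ek step_shift.
  by rewrite (step_const _ E) step_flip_out //; apply: noncong_small => //; rewrite /j; lia.
have st x : noncong n x i1 -> noncong n x j -> step (ht t) x = step (ht s) x.
  by move=> *; rewrite (step_const _ E) step_flip_out.
case/negP: nt; rewrite !st ?si ?si1 //.
- by move=> k Ek; apply: (ni (- k)); lia.
- by apply: (noncong_step n_ge3 hs); rewrite si1 sj0.
- by apply: (noncong_step n_ge3 hs); rewrite si si0.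
- exact: noncong_sym.
Qed.

Lemma move_of_tmove (i : 'I_n) s t : tmove i%:Z t false s ->
  i \in affine_des s /\ move s t.
Proof.
move=> [c [d [e [[k g] E]]]].
have hs := ht_height n_ge3 s; have hT := ht_height n_ge3 t.
set I := i%:Z + k * n%:Z in g.
have I1 : I + 1 = i%:Z + 1 + k * n%:Z by rewrite /I; lia.
have [m0 m1] := gmove_is_max n_ge3 hT g.
have s0 : step (ht s) I = 1 by rewrite (step_const _ E).
have s1 : step (ht s) (I + 1) = -1 by rewrite (step_const _ E).
split; first by move: s0 s1; rewrite I1 /I !step_shift // desE => -> ->.
have from2 (a b : int) (dd : nat) : (0 < dd <= n)%N -> b = a + dd%:Z -> move2_at a b s t -> move s t.
  move=> dn ab; have [oa [za Ea]] := ord_lift a; have [ob [zb Eb]] := ord_lift b.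
  rewrite Ea Eb move2_at_shift // => mv; apply/orP; right.
  by apply/existsP; exists oa; apply/existsP; exists ob.
move Em : false g => m g; case: g Em E => [//|t0 t1|p t0 t1 ex|r t0 t1 ex] _ E.
- apply/orP; left; apply/existsP; exists i; rewrite /move1_at.
  have -> : bar n i%:Z = bar n I by rewrite /I bar_shift.
  have -> : bar n (i%:Z + 1) = bar n (I + 1) by rewrite I1 bar_shift.
  have bt : bar n I \in top_row s by rewrite top_step // s0.
  have bb : bar n (I + 1) \in bot_row s by rewrite bot_step // s1.
  rewrite bt bb /=; apply/interchangeP => //; exists (- e).
  exact: ht_flip_sym.
- have len := exc_lt_n n_ge3 hT ex (or_introl t0).
  have [Ip _ _] := ex; have [_ tp] := exc_step n_ge3 hT ex.
  have pI : p <> I + 1 by move=> Ep; move: tp; rewrite Ep t1.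
  have Ed : p = I + 1 + (absz (p - I - 1)%R)%:Z by lia.
  have E1 : I + 1 - 1 = I by lia.
  apply: (from2 (I + 1) p (absz (p - I - 1)%R)) => //; first by lia.
  apply/(move2P n_ge3 _ _ _ Ed); first by lia.
  by rewrite E1; split=> //; [lia|left|split=> //; exists e].
- have len := exc_lt_n n_ge3 hT ex (or_intror t1).
  have [rI _ _] := ex; have [tr _] := exc_step n_ge3 hT ex.
  have rI' : I <> r + 1 by move=> Ep; move: tr; rewrite -Ep t0.
  have Ed : I = r + 1 + (absz (I - r - 1)%R)%:Z by lia.
  have E1 : r + 1 - 1 = r by lia.
  apply: (from2 (r + 1) I (absz (I - r - 1)%R)) => //; first by lia.
  apply/(move2P n_ge3 _ _ _ Ed); first by lia.
  by rewrite E1; split=> //; [lia|right|split=> //; exists e].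
Qed.

End TableauMoves.

(** * Relations between the maps g_i on tableaux *)

Section MoveComposition.
Variables n l1 l2 : nat.
Hypothesis n_ge3 : (3 <= n)%N.
Local Notation tab := (rsyt n l1 l2).
Implicit Types (s t u v w : tab) (x y : int).

Lemma gmove_mod_id i h m c d : height n h -> gmove_mod n i h m c d ->
  exists c' d' e : int, gmove i h m c' d' /\ forall x, flip n c d h x = flip n c' d' h x + e.
Proof.
move=> hh [k g]; exists (c + (- k) * n%:Z), (d + (- k) * n%:Z), 0; split.
  have := gmove_shift n_ge3 (- k) hh g.
  by have -> : i + k * n%:Z + - k * n%:Z = i by lia.
by move=> x; rewrite flip_shift // addr0.
Qed.

Lemma tmoveP i v m u : tmove i v m u <->
  exists c d e, gmove i (ht v) m c d /\ forall x, ht u x = flip n c d (ht v) x + e.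
Proof.
split=> [[c [d [e [g E]]]]|[c [d [e [g E]]]]]; last first.
  by exists c, d, e; split=> //; exists 0; rewrite mul0r addr0.
have [c' [d' [e' [g' E']]]] := gmove_mod_id (ht_height n_ge3 v) g.
by exists c', d', (e' + e); split=> // x; rewrite E E' addrA.
Qed.

Lemma tmove_fun i v m u m' u' : tmove i v m u -> tmove i v m' u' -> m = m' /\ u = u'.
Proof.
move=> /tmoveP[c [d [e [g E]]]] /tmoveP[c' [d' [e' [g' E']]]].
have [mm F] := gmove_fun n_ge3 g g'; split=> //.
by apply: (@ht_inj _ _ _ n_ge3 _ _ (e - e')) => x; rewrite E E' F; lia.
Qed.

Lemma tmove_max (i : 'I_n) v : i \in affine_des v -> tmove i%:Z v true v.
Proof.
rewrite desE // => /andP[/eqP s0 /eqP s1]; apply/tmoveP; exists 0, 0, 0.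
by split=> [|x]; [exact: gmax | rewrite flipK // addr0].
Qed.

Lemma tmove_des (i : 'I_n) v m u : tmove i%:Z v m u ->
  (i \in affine_des v) = m /\ (i \in affine_des u).
Proof.
move=> /tmoveP[c [d [e [g E]]]].
have [m0 m1] := gmove_is_max n_ge3 (ht_height n_ge3 v) g.
rewrite !desE // !(step_const _ E) m0 m1; split=> //.
by case: g => [? -> ->|-> ->|? -> ->|? -> ->].
Qed.

Lemma gmove_tab i v m c d : gmove i (ht v) m c d ->
  exists u e, forall x, ht u x = flip n c d (ht v) x + e.
Proof.
move=> g; case: m g => g.
  exists v, 0 => x; move Em : true g => m g; case: g Em => // c' _ _ _.
  by rewrite flipK // addr0.
have [sc sd] := gmove_steps n_ge3 (ht_height n_ge3 v) g.
have ct : bar n c \in top_row v by rewrite top_step // sc.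
have db : bar n d \in bot_row v by rewrite bot_step // sd.
have [u [iu _]] := swap_exists ct db; exists u.
by apply/interchangeP.
Qed.

Lemma flip_const (h h' : int -> int) (e c d : int) : (forall x, h' x = h x + e) ->
  forall x, flip n c d h' x = flip n c d h x + e.
Proof. by move=> E x; rewrite /flip E; lia. Qed.

Lemma gmove_tab_const i h v m c d (e : int) : (forall x, ht v x = h x + e) ->
  gmove i (ht v) m c d -> gmove i h m c d.
Proof. by move=> E; apply: (@gmove_const _ n_ge3 _ _ _ _ _ _ (- e)) => x; rewrite E addrK. Qed.

Lemma tmove_commute i j v m u m2 w : apart n i j -> tmove i v m u -> tmove j u m2 w ->
  exists m' u' m'', [/\ tmove j v m' u', tmove i u' m'' w & (m' + m'' = m + m2)%N].
Proof.
move=> ij /tmoveP[c [d [e [g E]]]] /tmoveP[c2 [d2 [e2 [g2 E2]]]].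
have hv := ht_height n_ge3 v.
have g2' := gmove_tab_const E g2.
have [m' [c' [d' [m'' [c'' [d'' [g' g'' ms F]]]]]]] := gmove_commute n_ge3 hv ij g g2'.
have [c1 [d1 [e1 [g1 F1]]]] := gmove_mod_id hv g'.
have [u' [e' E']] := gmove_tab g1.
have Eu x : ht u' x = flip n c' d' (ht v) x + (e' - e1) by rewrite F1 E'; lia.
exists m', u', m''; split=> //.
  by apply/tmoveP; exists c1, d1, e'.
have [k gk] := g''.
exists c'', d'', (e2 + e - (e' - e1)); split.
  by exists k; apply: (gmove_const n_ge3 Eu gk).
by move=> x; rewrite E2 (flip_const _ _ E) F (flip_const _ _ Eu); lia.
Qed.

Lemma tmove_adjacent i j v : j = i + 1 \/ j = i - 1 ->
  step (ht v) i = 1 -> step (ht v) (i + 1) = -1 ->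
  exists u, tmove j v false u /\ tmove i u false v.
Proof.
move=> ij s0 s1; have hv := ht_height n_ge3 v.
have [c [d [g1 g2]]] : exists c d, gmove j (ht v) false c d /\ gmove i (flip n c d (ht v)) false d c.
  by case: ij => ->; [exact: gmove_succ_max|exact: gmove_pred_max].
have [u [e E]] := gmove_tab g1; exists u; split; first by apply/tmoveP; exists c, d, e.
apply/tmoveP; exists d, c, (- e); split; first exact: (gmove_const n_ge3 E).
exact: ht_flip_sym.
Qed.

Lemma tmove_shift i k v m u : tmove (i + k * n%:Z) v m u <-> tmove i v m u.
Proof.
split=> - [c [d [e [[l g] E]]]]; exists c, d, e; split=> //.
  by exists (k + l); have -> : i + (k + l) * n%:Z = i + k * n%:Z + l * n%:Z by lia.
by exists (l - k); have -> : i + k * n%:Z + (l - k) * n%:Z = i + l * n%:Z by lia.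
Qed.

End MoveComposition.

(** * Modules over Hecke algebras *)

Local Open Scope quotient_scope.

Section HeckeAction.
Variables (I : finType) (V : lmodType laurent) (op : I -> V -> V).
Hypothesis op_lin : forall i, linear (op i).

Definition opw (w : seq I) (x : V) : V := foldr op x w.

Lemma opw_cat w w' x : opw (w ++ w') x = opw w (opw w' x).
Proof. exact: foldr_cat. Qed.

Lemma opw_lin w : linear (opw w).
Proof. by elim: w => [|i w IH] c x y //=; rewrite IH op_lin. Qed.

Definition ev (p : hecke_free I) (x : V) : V :=
  \sum_(m <- msupp p) p@_m *: opw (m : {fmonom I}) x.

Lemma ev_le (d : {fset {fmonom I}}) (p : hecke_free I) x : (msupp p `<=` d)%fset ->
  ev p x = \sum_(m <- d) p@_m *: opw m x.
Proof.
move=> sub; rewrite /ev (big_fset_incl _ sub) // => m _ /mcoeff_outdom ->.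
by rewrite scale0r.
Qed.

Lemma evD p p' x : ev (p + p') x = ev p x + ev p' x.
Proof.
rewrite (ev_le _ (msuppD_le p p')) (ev_le _ (fsubsetUl (msupp p) (msupp p'))).
rewrite (ev_le _ (fsubsetUr (msupp p) (msupp p'))) -big_split /=.
by apply: eq_bigr => m _; rewrite mcoeffD scalerDl.
Qed.

Lemma ev0 x : ev 0 x = 0.
Proof. by rewrite /ev msupp0 big_nil. Qed.

Lemma evU c (m : {fmonom I}) x : ev << c *g m >> x = c *: opw m x.
Proof. by rewrite (ev_le _ msuppU_le) big_seq_fset1 mcoeffUU. Qed.

Lemma ev_lin p : linear (ev p).
Proof.
move=> c x y; rewrite /ev scaler_sumr -big_split /=; apply: eq_bigr => m _.
by rewrite opw_lin scalerDr !scalerA mulrC.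
Qed.

Lemma ev_sum (J : Type) (r : seq J) (F : J -> hecke_free I) x :
  ev (\sum_(j <- r) F j) x = \sum_(j <- r) ev (F j) x.
Proof. by elim: r => [|j r IH]; rewrite ?big_nil ?ev0 // !big_cons evD IH. Qed.

Lemma evDr p x y : ev p (x + y) = ev p x + ev p y.
Proof. by have := ev_lin p 1 x y; rewrite !scale1r. Qed.

Lemma ev_0r p : ev p 0 = 0.
Proof. by apply: (addrI (ev p 0)); rewrite -evDr !addr0. Qed.

Lemma evZr p c x : ev p (c *: x) = c *: ev p x.
Proof. by have := ev_lin p c x 0; rewrite !addr0 ev_0r addr0. Qed.

Lemma ev_sumr (J : Type) (r : seq J) p (F : J -> V) :
  ev p (\sum_(j <- r) F j) = \sum_(j <- r) ev p (F j).
Proof. by elim: r => [|j r IH]; rewrite ?big_nil ?ev_0r // !big_cons evDr IH. Qed.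

Lemma evM p p' x : ev (p * p') x = ev p (ev p' x).
Proof.
rewrite {1}(monalgE p) mulr_suml ev_sum [RHS]/ev; apply: eq_bigr => m _.
rewrite {1}(monalgE p') mulr_sumr ev_sum [ev p' x]/ev.
rewrite -[in RHS](evU _ m) ev_sumr; apply: eq_bigr => m' _.
by rewrite malgM_def fgmulUU evZr !evU fmM opw_cat scalerA mulrC.
Qed.

Lemma ev1 x : ev 1 x = x.
Proof. by rewrite (evU 1 (fmone I)) scale1r fm1. Qed.

Lemma evA (c : laurent) x : ev c%:A x = c *: x.
Proof.
rewrite (ev_le _ (msuppZ_le c (1 : hecke_free I))) -{2}[x]ev1 scaler_sumr.
by apply: eq_bigr => m _; rewrite mcoeffZ scalerA.
Qed.

Lemma evN p x : ev (- p) x = - ev p x.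
Proof. by apply: (addrI (ev p x)); rewrite -evD !subrr ev0. Qed.

Lemma evB p p' x : ev (p - p') x = ev p x - ev p' x.
Proof. by rewrite evD evN. Qed.

Lemma ev_gen i x : ev (free_gen i) x = op i x.
Proof. by rewrite evU scale1r fmU. Qed.

Fixpoint alternate (k : nat) (i j : I) : seq I :=
  if k is k'.+1 then i :: alternate k' j i else [::].

Lemma ev_alt_prod k i j x : ev (alt_prod k i j) x = opw (alternate k i j) x.
Proof.
elim: k i j x => [|k IH] i j x; first by rewrite /alt_prod big_ord0 ev1.
rewrite /alt_prod big_ord_recl evM /= ev_gen -IH /alt_prod.
congr (op i (ev _ x)); apply: eq_bigr => l _ /=.
by rewrite /bump /=; case: (odd l).
Qed.

Variable M : I -> I -> nat.
Hypothesis quad : forall i x, op i (op i x + x) = q *: (op i x + x).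
Hypothesis braid : forall i j x, opw (alternate (M i j) i j) x = opw (alternate (M i j) j i) x.

(** This makes the evaluation independent of the representative chosen in [hecke_act]. *)
Lemma ev_ideal p : gen_ideal (@hecke_rel I M) p -> forall x, ev p x = 0.
Proof.
elim=> [{}p [i|i j]||p1 p2 _ IH1 _ IH2|a p1 _ IH|a p1 _ IH] x.
- by rewrite evM evB evA evD ev1 !ev_gen quad subrr.
- by rewrite evB !ev_alt_prod braid subrr.
- exact: ev0.
- by rewrite evD IH1 IH2 addr0.
- by rewrite evM IH ev_0r.
- by rewrite evM IH.
Qed.

Definition hecke_act (a : hecke M) (x : V) : V := ev (repr a) x.

Lemma hecke_act_pi p x : hecke_act (\pi_(ring_quot (@hecke_rel I M)) p) x = ev p x.
Proof.
apply/eqP; rewrite -subr_eq0 -evB; apply/eqP/ev_ideal.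
exact: ring_quot_repr.
Qed.

Lemma hecke_act_gen i x : hecke_act (hecke_gen M i) x = op i x.
Proof. by rewrite hecke_act_pi ev_gen. Qed.

Lemma hecke_act_module : is_hecke_module hecke_act.
Proof.
split.
- move=> v; rewrite -[1]/(rq_one (@hecke_rel I M)).
  have -> : rq_one (@hecke_rel I M) = \pi 1 by rewrite piE.
  by rewrite hecke_act_pi ev1.
- move=> a b v; rewrite -[a * b]/(rq_mul a b) -{1}[a]reprK -{1}[b]reprK.
  by rewrite -pi_rq_mul hecke_act_pi evM.
- move=> a b v; rewrite -[a + b]/(rq_add a b) -{1}[a]reprK -{1}[b]reprK.
  by rewrite -pi_rq_add hecke_act_pi evD.
- by move=> a u v; rewrite /hecke_act evDr.
- by move=> c v; rewrite hecke_act_pi evA.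
Qed.

End HeckeAction.

(** * The W-graph *)

Section WGraph.
Variables n l1 l2 : nat.
Hypothesis n_ge3 : (3 <= n)%N.
Local Notation tab := (rsyt n l1 l2).
Local Notation G := (affine_graph n l1 l2).
Implicit Types (s t u v w : tab) (i j : 'I_n) (m : bool) (phi psi : tab -> laurent).

(** By the W-graph formula, q - T_i sends a vertex with descent [i] to [1 + q] times itself minus
    [sqrtq] times the sum of its targets without descent [i], and kills all other vertices. *)
Definition mcoef m : laurent := if m then 1 + q else - sqrtq.

(* The matrix of q - T_i acting on coordinates, with entry at row v, column u. *)
Definition kernel i v u : laurent :=
  if i \in affine_des v then (1 + q) *+ (u == v)
  else if i \in affine_des u then - sqrtq *+ move u v else 0.

Definition pull i phi v : laurent := \sum_u kernel i v u * phi u.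

(** Row [v] of [kernel] is supported in the single column g_i v: an edge into [v] that creates the
    descent [i] is g_i read backwards, and g_i is a function. *)
Lemma pull_tmove i v m u phi : tmove i%:Z v m u -> pull i phi v = mcoef m * phi u.
Proof.
move=> g; have [dv du] := tmove_des n_ge3 g.
rewrite /pull /kernel dv /mcoef; case: m g dv => g dv.
  have [_ <-] := tmove_fun n_ge3 g (tmove_max n_ge3 dv).
  rewrite (bigD1 u) //= eqxx mulr1n big1 ?addr0 // => w /negPf->.
  by rewrite mulr0n mul0r.
have [_ muv] := move_of_tmove n_ge3 g.
rewrite (bigD1 u) //= du muv mulr1n big1 ?addr0 // => w /negP wu.
case: ifP => dw; last by rewrite mul0r.
case mwv: (move w v); last by rewrite mulr0n mul0r.
case: wu; apply/eqP; have gw := tmove_of_move n_ge3 (negbT dv) dw mwv.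
by have [] := tmove_fun n_ge3 gw g.
Qed.

Lemma pull_none i v phi : (forall m u, ~ tmove i%:Z v m u) -> pull i phi v = 0.
Proof.
move=> no; have [dv|dv] := boolP (i \in affine_des v).
  by case: (no _ _ (tmove_max n_ge3 dv)).
apply: big1 => u _; rewrite /kernel (negPf dv); case: ifP => du; last by rewrite mul0r.
case muv: (move u v); last by rewrite mulr0n mul0r.
by case: (no _ _ (tmove_of_move n_ge3 dv du muv)).
Qed.

Lemma tmove_dec i v : (exists m u, tmove i%:Z v m u) \/ (forall m u, ~ tmove i%:Z v m u).
Proof.
have [H|H] := pselect (exists m u, tmove i%:Z v m u); first by left.
by right=> m u g; apply: H; exists m, u.
Qed.

(** A nonzero value ensures that g_j g_i is defined at [v], as [tmove_commute] requires. If the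
    values in both orders vanish, they agree anyway. *)
Lemma pull_pull_sym i j phi v : apart n i%:Z j%:Z ->
  pull i (pull j phi) v != 0 -> pull i (pull j phi) v = pull j (pull i phi) v.
Proof.
move=> ij; have [[m [u g]]|no] := tmove_dec i v; last by rewrite pull_none ?eqxx.
have [[m2 [w g2]]|no] := tmove_dec j u; last by rewrite (pull_tmove _ g) (pull_none _ no) mulr0 eqxx.
have [m' [u' [m'' [g' g'' ms]]]] := tmove_commute n_ge3 ij g g2.
rewrite (pull_tmove _ g) (pull_tmove _ g2) (pull_tmove _ g') (pull_tmove _ g'') => _.
rewrite !mulrA; congr (_ * _).
by move: ms; rewrite /mcoef; case: m g; case: m2 g2; case: m' g'; case: m'' g'' => //= *; rewrite mulrC.
Qed.

Lemma pull_commute i j phi v : apart n i%:Z j%:Z ->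
  pull i (pull j phi) v = pull j (pull i phi) v.
Proof.
move=> ij; have [e1|/(pull_pull_sym ij)//] := eqVneq (pull i (pull j phi) v) 0.
have [e2|/(pull_pull_sym (apart_sym n_ge3 ij))//] := eqVneq (pull j (pull i phi) v) 0.
by rewrite e1 e2.
Qed.

Lemma pull_idem i phi v : pull i (pull i phi) v = (1 + q) * pull i phi v.
Proof.
have [[m [u g]]|no] := tmove_dec i v; last by rewrite !pull_none // mulr0.
have [_ du] := tmove_des n_ge3 g; have gu := tmove_max n_ge3 du.
by rewrite !(pull_tmove _ g) (pull_tmove _ gu) mulrCA.
Qed.

(** On the image of g_i, the map g_i undoes g_j. Neither of these two maps fixes its argument there,
    so the scalars are [- sqrtq] twice, with product [q]. *)
Lemma pull_adjacent i j phi v (k : int) :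
  j%:Z = i%:Z + 1 + k * n%:Z \/ j%:Z = i%:Z - 1 + k * n%:Z ->
  pull i (pull j (pull i phi)) v = q * pull i phi v.
Proof.
move=> ij; have [[m [u g]]|no] := tmove_dec i v; last by rewrite !pull_none // mulr0.
have [_] := tmove_des n_ge3 g; rewrite desE // => /andP[/eqP s0 /eqP s1].
have [u' [g1 g2]] : exists u', tmove j%:Z u false u' /\ tmove i%:Z u' false u.
  case: ij => ->.
    have [|u' [g1 g2]] := @tmove_adjacent _ _ _ n_ge3 i%:Z (i%:Z + 1) u _ s0 s1; first by left.
    by exists u'; rewrite tmove_shift.
  have [|u' [g1 g2]] := @tmove_adjacent _ _ _ n_ge3 i%:Z (i%:Z - 1) u _ s0 s1; first by right.
  by exists u'; rewrite tmove_shift.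
rewrite !(pull_tmove _ g) (pull_tmove _ g1) (pull_tmove _ g2) /mcoef.
by rewrite [RHS]mulrCA; congr (_ * _); rewrite mulrA mulrNN.
Qed.

Lemma eq_pull i phi psi : phi =1 psi -> pull i phi =1 pull i psi.
Proof. by move=> E v; apply: eq_bigr => u _; rewrite E. Qed.

Lemma pullB i (c : laurent) phi psi v :
  pull i (fun u => c * phi u - psi u) v = c * pull i phi v - pull i psi v.
Proof.
rewrite /pull mulr_sumr -sumrB; apply: eq_bigr => u _.
by rewrite mulrBr mulrCA.
Qed.

Definition twist i phi v := q * phi v - pull i phi v.

Lemma eq_twist i phi psi : phi =1 psi -> twist i phi =1 twist i psi.
Proof. by move=> E v; rewrite /twist E (eq_pull i E). Qed.

Lemma pull_twist i j phi v : pull i (twist j phi) v = q * pull i phi v - pull i (pull j phi) v.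
Proof. exact: pullB. Qed.

Lemma twist_commute i j phi v : apart n i%:Z j%:Z ->
  twist i (twist j phi) v = twist j (twist i phi) v.
Proof.
move=> ij; rewrite {1 3}/twist !pull_twist (pull_commute _ _ ij) /twist; ring.
Qed.

Lemma twist_braid i j phi v (k : int) :
  j%:Z = i%:Z + 1 + k * n%:Z \/ j%:Z = i%:Z - 1 + k * n%:Z ->
  twist i (twist j (twist i phi)) v = twist j (twist i (twist j phi)) v.
Proof.
move=> ij.
have ji : i%:Z = j%:Z + 1 + (- k) * n%:Z \/ i%:Z = j%:Z - 1 + (- k) * n%:Z by lia.
have E a b : twist a (twist b (twist a phi)) v = q * (q * (q * phi v - pull a phi v)
    - (q * pull b phi v - pull b (pull a phi) v))
    - (q * (q * pull a phi v - pull a (pull a phi) v)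
       - (q * pull a (pull b phi) v - pull a (pull b (pull a phi)) v)).
  rewrite {1}/twist pull_twist {1}/twist !pull_twist /twist.
  rewrite (eq_pull a (pull_twist b a phi)) pullB.
  done.
(* The terms in F_i alone now add up to - q^2 F_i, like the one in F_j, so the expansion is
   symmetric in [i] and [j]. *)
rewrite !E !pull_idem (pull_adjacent _ _ ij) (pull_adjacent _ _ ji).
ring.
Qed.

(** * The operators T_i on the vertex module *)

Local Notation V := {malg laurent[tab]}.

Definition wop i (x : V) : V := \sum_(u : tab) x@_u *: (@wgraph_formula _ G i u : V).

Lemma wop_linear i : linear (wop i).
Proof.
move=> c x y; rewrite /wop scaler_sumr -big_split /=; apply: eq_bigr => u _.
by rewrite mcoeffD mcoeffZ scalerDl scalerA.
Qed.

Lemma wop_basis i u : wop i << u >> = @wgraph_formula _ G i u.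
Proof.
rewrite /wop (bigD1 u) //= mcoeffUU scale1r big1 ?addr0 // => w /negPf wu.
by rewrite mcoeffU eq_sym wu scale0r.
Qed.

Lemma formula_coeff i u v :
  (@wgraph_formula _ G i u : V)@_v = q *+ (u == v) - kernel i v u.
Proof.
rewrite /wgraph_formula /kernel /= /vertex_basis; have [du|du] := boolP (i \in affine_des u).
  rewrite mcoeffD mcoeffN mcoeffU mcoeffZ raddf_sum /=.
  have -> : \sum_(w | i \notin affine_des w) ((move u w)%:R *: << w >> : V)@_v
      = if i \in affine_des v then 0 else (move u v)%:R.
    have C w : ((move u w)%:R *: << w >> : V)@_v = (move u w)%:R *+ (w == v).
      by rewrite mcoeffZ mcoeffU mulrnAr mulr1.
    rewrite (eq_bigr _ (fun w _ => C w)); case: ifP => dv.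
      by apply: big1 => w dw; case: eqP dw => // ->; rewrite dv.
    rewrite (bigD1 v) ?dv // eqxx mulr1n big1 => [|w /andP[_ /negPf->] //].
    exact: addr0.
  have [dv|dv] := boolP (i \in affine_des v).
    by rewrite mulr0 addr0; case: (u == v); rewrite ?mulr1n ?mulr0n ?oppr0 ?subr0 //; ring.
  have -> : (u == v) = false by apply: contraNF dv => /eqP <-.
  by rewrite !mulr0n oppr0 !add0r; case: (move u v); rewrite ?mulr1n ?mulr0n ?mulr1 ?mulr0 ?opprK ?oppr0.
rewrite mcoeffZ mcoeffU; have [dv|dv] := boolP (i \in affine_des v).
  have -> : (u == v) = false by apply: contraNF du => /eqP ->.
  by rewrite !mulr0n mulr0 subr0.
by rewrite subr0 mulrnAr mulr1.
Qed.

Lemma wop_coeff i (x : V) v : (wop i x)@_v = twist i (fun u => x@_u) v.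
Proof.
rewrite /wop raddf_sum /twist /pull /=.
transitivity (\sum_(u : tab) (q * (x@_u *+ (u == v)) - kernel i v u * x@_u)).
  apply: eq_bigr => u _; rewrite mcoeffZ formula_coeff mulrBr [_ * kernel _ _ _]mulrC.
  by congr (_ - _); rewrite mulrC mulrnAl mulrnAr.
rewrite sumrB -mulr_sumr; congr (q * _ - _).
by rewrite (bigD1 v) //= eqxx mulr1n big1 ?addr0 // => u /negPf->.
Qed.

Lemma wop_quad i (x : V) : wop i (wop i x + x) = q *: (wop i x + x).
Proof.
apply/malgP => v; rewrite wop_coeff mcoeffZ mcoeffD wop_coeff.
have E : (fun u => (wop i x + x)@_u) =1
    (fun u => (q + 1) * x@_u - pull i (fun u => x@_u) u).
  by move=> u; rewrite mcoeffD wop_coeff /twist; ring.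
rewrite (eq_twist i E) {1}/twist pullB pull_idem /twist; ring.
Qed.

Lemma apart_of_nonadjacent i j : i != j ->
  ~~ ((val j == i.+1 %% n)%N || (val i == j.+1 %% n)%N) -> apart n i%:Z j%:Z.
Proof.
move=> /eqP ij /norP[/eqP ji1 /eqP ij1].
have ij' : (i : nat) <> j by move=> /val_inj.
have ni := ltn_ord i; have nj := ltn_ord j.
have modS (a : 'I_n) : (a.+1 %% n)%N = if a.+1 == n then 0%N else a.+1.
  by case: eqP => [->|ne]; [rewrite modnn|rewrite modn_small //; have := ltn_ord a; lia].
rewrite /= !modS in ji1 ij1; move: ji1 ij1; do 2 case: eqP => ?; move=> *;
by split=> k; have := muln_cases n_ge3 k; have := muln_cases n_ge3 (k - 1);
  have := muln_cases n_ge3 (k + 1); lia.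
Qed.

Lemma ord_succ_lift i j : (val j == i.+1 %% n)%N ->
  exists k : int, j%:Z = i%:Z + 1 + k * n%:Z.
Proof.
move=> /eqP; rewrite /= => ->; have := divn_eq i.+1 n => E.
by exists (- (i.+1 %/ n)%N%:Z); lia.
Qed.

Lemma wop_braid i j (x : V) :
  opw wop (alternate (affine_coxeter i j) i j) x = opw wop (alternate (affine_coxeter i j) j i) x.
Proof.
have C2 a b v : (wop a (wop b x))@_v = twist a (twist b (fun u => x@_u)) v.
  by rewrite wop_coeff; apply: eq_twist => u; rewrite wop_coeff.
rewrite /affine_coxeter; case: eqP => [->//|/eqP ij]; case: ifP => [adj|nadj] /=; last first.
  apply/malgP => v; apply: etrans (C2 i j v) (etrans _ (esym (C2 j i v))); apply: twist_commute.
  by apply: apart_of_nonadjacent; rewrite ?nadj.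
have C3 a b v : (wop a (wop b (wop a x)))@_v = twist a (twist b (twist a (fun u => x@_u))) v.
  by rewrite wop_coeff; apply: eq_twist => u; exact: C2.
apply/malgP => v; apply: etrans (C3 i j v) (etrans _ (esym (C3 j i v))).
have [k ijk] : exists k : int, j%:Z = i%:Z + 1 + k * n%:Z \/ j%:Z = i%:Z - 1 + k * n%:Z.
  case/orP: adj => /ord_succ_lift [k E]; first by exists k; left.
  by exists (- k); right; rewrite E; lia.
exact: twist_braid ijk.
Qed.

End WGraph.

Local Close Scope quotient_scope.
Local Close Scope ring_scope.

Theorem theorem4p9 (n l1 l2 : nat) (n_ge3 : 3 <= n) (l12_n : l1 + l2 = n)
  (l2_le_l1 : l2 <= l1) (l2_ge1 : 1 <= l2) :
  is_wgraph (@affine_coxeter n) (affine_graph n l1 l2).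
Proof.
exists (hecke_act (M := @affine_coxeter n) (@wop n l1 l2)).
  apply: hecke_act_module; [exact: wop_linear|exact: wop_quad|exact: wop_braid].
move=> i u; rewrite hecke_act_gen ?wop_basis //.
- exact: wop_linear.
- exact: wop_quad.
- exact: wop_braid.
Qed.
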